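(* Let $f:(M,Q)\to\mathbb{R}^n$ be isothermic on a polarised Riemann surface, with Christoffel transform $f^c$, and let $(f,\hat f)$ be a Darboux pair with $\hat f=\mathcal{D}_rf$, $r\in\mathbb{R}\setminus\{0\}$. Then the associated family $(f_{(\lambda)},\hat f_{(\lambda)})$, $\lambda\in\mathbb{R}\setminus\{0\}$, of $(f,\hat f)$ (viewed as a curved flat) consists of $T$-transforms of the pair: modulo the action of the Möbius group, $$f_{(\lambda)}=\mathcal{T}_{(1-\lambda^2)r}f,\qquad \hat f_{(\lambda)}=\mathcal{T}_{(1-\lambda^2)r}\hat f .$$
   Context: $C\ell_n$ is the real Clifford algebra of Euclidean $\mathbb{R}^n$, with $vw+wv=-2(v,w)1$; $\Gamma_n\subset C\ell_n^\times$ is the group generated by nonzero vectors; $a\mapsto a^t$ is the anti-involution fixing vectors. $SL(\Gamma_n)$ is the group of matrices $\begin{pmatrix}a&b\\ c&d\end{pmatrix}$ with $a,b,c,d\in\Gamma_n\cup\{0\}$, $ac^t,bd^t,a^tb,c^td\in\mathbb{R}^n$, $ad^t-bc^t=1$, acting on $\mathbb{R}^n\cup\{\infty\}$ by the Möbius (conformal) transformations $x\mapsto(ax+b)(cx+d)^{-1}$, $\infty\mapsto ac^{-1}$. For Clifford-valued 1-forms, $(\alpha\wedge\beta)(X,Y)=\alpha(X)\beta(Y)-\alpha(Y)\beta(X)$. A polarised Riemann surface $(M,Q)$ is a Riemann surface with a nonzero holomorphic quadratic differential $Q$. A conformal immersion $f:(M,Q)\to\mathbb{R}^n$ is isothermic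 if there is $f^c:M\to\mathbb{R}^n$ (the Christoffel transform, unique up to translation) with $df\wedge df^c=0$ and $(df,df^c)^{2,0}=Q$, where $(\alpha,\beta)^{2,0}=(\alpha(\partial_z),\beta(\partial_z))dz^2$. $\mathcal{D}_rf$ denotes any $f+g$ with $g:M\to\mathbb{R}^n$ a (nowhere zero) solution of $dg=r\,g\,df^c\,g-df$; it is isothermic on $(M,Q)$ with Christoffel transform $f^c+(rg)^{-1}$. $T$-transform: for isothermic $f:(M,Q)\to\mathbb{R}^n$ with Christoffel transform $f^c$ and $r\in\mathbb{R}$, $\mathcal{T}_rf=F_r\cdot 0$ where $F_r:M\to SL(\Gamma_n)$ solves $F_r^{-1}dF_r=\begin{pmatrix}0&df\\ r\,df^c&0\end{pmatrix}$; it is defined up to the Möbius group. Associated family: the Darboux pair is a curved flat in the symmetric space $Z=SL(\Gamma_n)/K$ of pairs of distinct points of $\mathbb{R}^n\cup\{\infty\}$, where $K$, the stabiliser of $(0,\infty)$, is the diagonal subgroup. Choose a frame $F:M\to SL(\Gamma_n)$, $F\cdot0=f$, $F\cdot\infty=\hat f$, and write $F^{-1}dF=A_{\mathfrak{k}}+A_{\mathfrak{p}}$ (diagonal and off-diagonal parts). For $\lambda\in\mathbb{R}$, $A_{\mathfrak{k}}+\lambda A_{\mathfrak{p}}$ satisfies the Maurer–Cartan equation. Let $F_\lambda:M\to SL(\Gamma_n)$ solve $F_\lambda^{-1}dF_\lambda=A_{\mathfrak{k}}+\lambda A_{\mathfrak{p}}$ and set $(f_{(\lambda)},\hat f_{(\lambda)})=(F_\lambda\cdot0,F_\lambda\cdot\infty)$;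 this is independent of the choice of $F$ and well defined up to the Möbius group. Maps are smooth, $M$ is simply connected (statements are local), and transforms are considered away from the zeros of $Q$ where immersions are required. *)

(* Defs.v *)
From HB Require Import structures.
From mathcomp Require Import all_boot all_order all_algebra falgebra ring zify.
Set Implicit Arguments.
Unset Strict Implicit.
Unset Printing Implicit Defensive.
Import Order.TTheory GRing.Theory Num.Theory.
Local Open Scope ring_scope.

Section Clifford.
Variables (R : fieldType) (n : nat).
Implicit Types (S T U V : {set 'I_n}).

Definition symdiff S T : {set 'I_n} := (S :\: T) :|: (T :\: S).

Lemma in_symdiff S T i : (i \in symdiff S T) = (i \in S) (+) (i \in T).
Proof. by rewrite !inE; case: (i \in S); case: (i \in T). Qed.

Lemma symdiffA : associative symdiff.
Proof. by move=> S T U; apply/setP=> i; rewrite !in_symdiff addbA. Qed.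

Lemma symdiffC : commutative symdiff.
Proof. by move=> S T; apply/setP=> i; rewrite !in_symdiff addbC. Qed.

Lemma symdiffK S : involutive (symdiff S).
Proof. by move=> T; apply/setP=> i; rewrite !in_symdiff addKb. Qed.

Lemma symdiff0 S : symdiff S set0 = S.
Proof. by apply/setP=> i; rewrite in_symdiff inE addbF. Qed.

Lemma symdiffSS S : symdiff S S = set0.
Proof. by apply/setP=> i; rewrite in_symdiff inE addbb. Qed.

(* e_S * e_T = cl_sign S T *: e_(S + T) for the increasing products e_S of the
   generators: moving e_j to the left of e_i for j < i costs a sign, and so
   does e_i * e_i = -1. *)
Definition cl_sign S T : R := (-1) ^+ (\sum_(i in S) \sum_(j in T) (j <= i))%N.

Definition clifford : Type := {ffun {set 'I_n} -> R^o}.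
HB.instance Definition _ := Vector.on clifford.

Definition cl_one : clifford := [ffun S => (S == set0)%:R].
Definition cl_mul (a b : clifford) : clifford :=
  [ffun U => \sum_S cl_sign S (symdiff S U) * a S * b (symdiff S U)].

Lemma cl_signE S T : cl_sign S T =
  \prod_i \prod_j (if (i \in S) && (j \in T) then (-1) ^+ (j <= i)%N else 1).
Proof.
rewrite /cl_sign expr_sum big_mkcond; apply: eq_bigr => i _.
case: (i \in S) => /=; last by rewrite big1.
by rewrite expr_sum big_mkcond.
Qed.

Lemma cl_signDl S T U : cl_sign (symdiff S T) U = cl_sign S U * cl_sign T U.
Proof.
rewrite !cl_signE -big_split; apply: eq_bigr => i _; rewrite -big_split.
apply: eq_bigr => j _ /=; rewrite in_symdiff.
by case: (i \in S); case: (i \in T); case: (j \in U);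
  rewrite /= ?mulr1 ?mul1r // -expr2 sqrr_sign.
Qed.

Lemma cl_signDr S T U : cl_sign S (symdiff T U) = cl_sign S T * cl_sign S U.
Proof.
rewrite !cl_signE -big_split; apply: eq_bigr => i _; rewrite -big_split.
apply: eq_bigr => j _ /=; rewrite in_symdiff.
by case: (i \in S); case: (j \in T); case: (j \in U);
  rewrite /= ?mulr1 ?mul1r // -expr2 sqrr_sign.
Qed.

Lemma cl_sign0l S : cl_sign set0 S = 1.
Proof. by rewrite /cl_sign big_set0. Qed.

Lemma cl_sign0r S : cl_sign S set0 = 1.
Proof. by rewrite /cl_sign big1 // => i _; rewrite big_set0. Qed.

Lemma cl_mulA : associative cl_mul.
Proof.
move=> a b c; apply/ffunP=> U; rewrite !ffunE.
transitivity (\sum_S \sum_V cl_sign S S * cl_sign S V * cl_sign V V *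
    cl_sign V U * (a S * b (symdiff S V) * c (symdiff V U))).
  apply: eq_bigr => S _; rewrite ffunE mulr_sumr.
  rewrite (reindex_inj (inv_inj (symdiffK S))) /=; apply: eq_bigr => V _.
  have -> : symdiff (symdiff S V) (symdiff S U) = symdiff V U.
    by rewrite (symdiffC S V) -symdiffA symdiffK.
  rewrite cl_signDl !cl_signDr.
  transitivity ((cl_sign S U * cl_sign S U) *
    (cl_sign S S * cl_sign S V * cl_sign V V * cl_sign V U *
    (a S * b (symdiff S V) * c (symdiff V U)))); first ring.
  by rewrite -expr2 sqrr_sign mul1r.
rewrite exchange_big; apply: eq_bigr => V _ /=.
rewrite ffunE mulr_sumr mulr_suml; apply: eq_bigr => S _.
rewrite !cl_signDr; ring.
Qed.

Lemma cl_mul1l : left_id cl_one cl_mul.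
Proof.
move=> a; apply/ffunP=> U; rewrite ffunE (bigD1 set0) //= big1 => [|S S0].
  by rewrite symdiffC symdiff0 cl_sign0l ffunE eqxx !mul1r addr0.
by rewrite ffunE (negPf S0) mulr0 mul0r.
Qed.

Lemma cl_mul1r : right_id cl_one cl_mul.
Proof.
move=> a; apply/ffunP=> U; rewrite ffunE (bigD1 U) //= big1 => [|S SU].
  by rewrite symdiffSS cl_sign0r ffunE eqxx mulr1 mul1r addr0.
rewrite ffunE; case: eqP => [SU0|_]; last by rewrite mulr0.
by move: SU; rewrite -(symdiffK S U) SU0 symdiff0 eqxx.
Qed.

Lemma cl_mulDl : left_distributive cl_mul +%R.
Proof.
move=> a b c; apply/ffunP=> U; rewrite !ffunE -big_split; apply: eq_bigr => S _.
by rewrite ffunE mulrDr mulrDl.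
Qed.

Lemma cl_mulDr : right_distributive cl_mul +%R.
Proof.
move=> a b c; apply/ffunP=> U; rewrite !ffunE -big_split; apply: eq_bigr => S _.
by rewrite ffunE mulrDr.
Qed.

Lemma cl_one_neq0 : cl_one != 0.
Proof. by apply/eqP => /ffunP/(_ set0); rewrite !ffunE eqxx; apply/eqP/oner_neq0. Qed.

HB.instance Definition _ := GRing.Zmodule_isNzRing.Build clifford
  cl_mulA cl_mul1l cl_mul1r cl_mulDl cl_mulDr cl_one_neq0.

Lemma cl_scalerAl (k : R) (a b : clifford) : k *: (a * b) = (k *: a) * b.
Proof.
apply/ffunP=> U; rewrite !ffunE scaler_sumr; apply: eq_bigr => S _.
by rewrite ffunE /GRing.scale /=; ring.
Qed.

HB.instance Definition _ := GRing.Lmodule_isLalgebra.Build R clifford cl_scalerAl.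

Lemma cl_scalerAr (k : R) (a b : clifford) : k *: (a * b) = a * (k *: b).
Proof.
apply/ffunP=> U; rewrite !ffunE scaler_sumr; apply: eq_bigr => S _.
by rewrite ffunE /GRing.scale /=; ring.
Qed.

HB.instance Definition _ := GRing.Lalgebra_isAlgebra.Build R clifford cl_scalerAr.
HB.instance Definition _ := Algebra_isFalgebra.Build R clifford.

Definition cl_vec (v : 'rV[R]_n) : clifford :=
  [ffun S => \sum_i v 0 i * (S == [set i])%:R].

Definition vec_part (a : clifford) : 'rV[R]_n := \row_i a [set i].

Definition dot (v w : 'rV[R]_n) : R := \sum_i v 0 i * w 0 i.

(* Reversing a product of k distinct generators takes 'C(k, 2) swaps. *)
Definition cl_tr (a : clifford) : clifford :=
  [ffun S : {set 'I_n} => (-1) ^+ 'C(#|S|, 2) * a S].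

Lemma cl_vecK : cancel cl_vec vec_part.
Proof.
move=> v; apply/rowP=> i; rewrite !mxE ffunE (bigD1 i) //= eqxx mulr1 big1 ?addr0 //.
by move=> j ji; rewrite (inj_eq set1_inj) eq_sym (negPf ji) mulr0.
Qed.

Definition cl_basis S : clifford := [ffun T => (T == S)%:R].

Lemma cl_basisE (a : clifford) : a = \sum_S a S *: cl_basis S.
Proof.
apply/ffunP=> U; rewrite sum_ffunE (bigD1 U) //= big1 => [|S SU].
  by rewrite !ffunE eqxx /GRing.scale /= mulr1 addr0.
by rewrite !ffunE eq_sym (negPf SU) scaler0.
Qed.

Lemma cl_basisM S T :
  cl_basis S * cl_basis T = cl_sign S T *: cl_basis (symdiff S T).
Proof.
apply/ffunP=> U; rewrite !ffunE (bigD1 S) //= big1 => [|V VS].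
  rewrite !ffunE eqxx mulr1 addr0 -(inj_eq (inv_inj (symdiffK S))) symdiffK.
  by case: eqP => [->|_]; rewrite ?symdiffK //= /GRing.scale /= ?mulr0.
by rewrite ffunE (negPf VS) mulr0 mul0r.
Qed.

Lemma cl_vecE v : cl_vec v = \sum_i v 0 i *: cl_basis [set i].
Proof.
apply/ffunP=> U; rewrite ffunE sum_ffunE; apply: eq_bigr => i _.
by rewrite !ffunE.
Qed.

Lemma cl_vec_comm v w : cl_vec v * cl_vec w + cl_vec w * cl_vec v = - (2 * dot v w)%:A.
Proof.
have E x y : cl_vec x * cl_vec y = \sum_i \sum_j (x 0 i * y 0 j) *:
    (cl_basis [set i] * cl_basis [set j]).
  rewrite !cl_vecE mulr_suml; apply: eq_bigr => i _; rewrite mulr_sumr.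
  by apply: eq_bigr => j _; rewrite -scalerAl -scalerAr scalerA.
rewrite !E [X in _ + X]exchange_big -big_split /= mulr_sumr scaler_suml -sumrN.
apply: eq_bigr => i _; rewrite -big_split (bigD1 i) //= big1 => [|j ji].
  rewrite cl_basisM symdiffSS /cl_sign !big_set1 leqnn expr1 addr0.
  rewrite [w 0 i * _]mulrC -scalerDl scalerA mulrN1 scaleNr; congr (- (_ *: _)).
  by rewrite mulr_natl mulr2n.
rewrite !cl_basisM (symdiffC [set j]) !scalerA [w 0 j * _]mulrC -scalerDl -mulrDr.
rewrite /cl_sign !big_set1 [X in _ * X](_ : _ = 0) ?mulr0 ?scale0r //.
by case: ltngtP ji => [||/val_inj->]; rewrite ?eqxx // expr1 expr0 ?subrr ?addNr.
Qed.

Lemma cl_basis_prod S : cl_basis S = \prod_(i in S) cl_vec (delta_mx 0 i).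
Proof.
have vE i : cl_vec (delta_mx 0 i) = cl_basis [set i].
  rewrite cl_vecE (bigD1 i) //= big1 => [|j ji]; rewrite mxE eqxx.
    by rewrite eqxx scale1r addr0.
  by rewrite (negPf ji) scale0r.
rewrite -big_filter [X in \prod_(i <- X) _](_ : _ = enum S); last first.
  by rewrite /enum_mem unlock.
under eq_bigr do rewrite vE.
rewrite -[in LHS](set_enum S).
have : sorted (fun i j : 'I_n => i < j)%N (enum S).
  rewrite /enum_mem; apply: sorted_filter => [? ? ?|]; first exact: ltn_trans.
  have := iota_ltn_sorted 0 n.
  by rewrite -val_enum_ord sorted_map enumT.
elim: (enum S) => [|i s IHs] srt /=.
  by rewrite big_nil; apply/ffunP=> U; rewrite !ffunE set_nil.
rewrite big_cons -IHs ?(path_sorted srt) // cl_basisM.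
have {}srt := order_path_min (fun _ _ _ => @ltn_trans _ _ _) srt.
have si : i \notin s by apply/negP => /(allP srt); rewrite ltnn.
rewrite /cl_sign big_set1 big1 => [|j]; last first.
  by rewrite inE => /(allP srt); rewrite ltnNge => /negPf->.
rewrite expr0 scale1r; congr cl_basis; apply/setP=> j; rewrite in_symdiff !inE.
by case: eqP => [->|_]; rewrite ?(negPf si).
Qed.

Lemma cl_tr_vec v : cl_tr (cl_vec v) = cl_vec v.
Proof.
apply/ffunP=> S; rewrite !ffunE mulr_sumr; apply: eq_bigr => i _.
by case: eqP => [->|_]; rewrite ?mulr0 // cards1 mul1r.
Qed.

Lemma cl_trK : involutive cl_tr.
Proof. by move=> a; apply/ffunP=> S; rewrite !ffunE signrMK. Qed.

Lemma cl_sign_swap S T :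
  cl_sign S T * cl_sign T S = (-1) ^+ (#|S| * #|T| + #|S :&: T|).
Proof.
have -> : (#|S| * #|T| + #|S :&: T| =
    \sum_i \sum_j (((i \in S) && (j \in T)) + [&& i \in S, j \in T & i == j]))%N.
  rewrite -!sum1_card big_distrl [X in (X + _)%N]big_mkcond [X in (_ + X)%N]big_mkcond.
  rewrite -big_split; apply: eq_bigr => i _ /=; rewrite big_split /= inE.
  rewrite [X in (_ = _ + X)%N](bigD1 i) //= eqxx andbT [X in (_ + (_ + X))%N]big1.
    rewrite addn0; case: (i \in S) => /=; last by rewrite big1.
    rewrite mul1n big_mkcond; apply: congr2; last by case: (i \in T).
    by apply: eq_bigr => j _; case: (j \in T).
  by move=> j ji; rewrite eq_sym (negPf ji) !andbF.
rewrite expr_sum !cl_signE [X in _ * X]exchange_big -big_split.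
apply: eq_bigr => i _; rewrite expr_sum -big_split; apply: eq_bigr => j _ /=.
rewrite andbC; case: (j \in T); case: (i \in S); rewrite /= ?mulr1 //.
by rewrite -exprD; case: (ltngtP i j) => [||/val_inj->]; rewrite ?eqxx // => ij;
  case: eqP ij => // ->; rewrite ltnn.
Qed.

Lemma cl_sign_bin k m : (-1) ^+ 'C(k.*2 + m, 2) = (-1) ^+ (k + 'C(m, 2)) :> R.
Proof.
elim: k => // k IHk; rewrite doubleS !addSn !binS !bin1 bin0.
have -> x y : (x + y + (y + 1) = (y.*2 + (x + 1)))%N by rewrite -addnn; lia.
by rewrite exprD -mul2n exprM sqrrN !expr1n mul1r addn1 exprS IHk -exprS.
Qed.

Lemma bin2D s t : 'C(s + t, 2) = ('C(s, 2) + 'C(t, 2) + s * t)%N.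
Proof.
elim: s => [|s IHs]; first by rewrite bin0n mul0n addn0.
by rewrite addSn !binS !bin1 IHs mulSn; lia.
Qed.

Lemma cl_sign_tr S T : (-1) ^+ 'C(#|symdiff S T|, 2) * cl_sign S T =
  (-1) ^+ 'C(#|S|, 2) * (-1) ^+ 'C(#|T|, 2) * cl_sign T S.
Proof.
have cST : (#|S :&: T|.*2 + #|symdiff S T| = #|S| + #|T|)%N.
  rewrite -(cardsID T S) -(cardsID S T) (setIC T) /symdiff cardsU.
  rewrite (_ : _ :&: (T :\: S) = set0) ?cards0; first by rewrite -addnn; lia.
  by apply/setP=> i; rewrite !inE; case: (i \in S); rewrite ?andbF.
have := cl_sign_bin #|S :&: T| #|symdiff S T|.
rewrite cST bin2D !exprD => /(congr1 (fun x => x * (-1) ^+ #|S :&: T|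
  * cl_sign S T * (cl_sign T S * cl_sign T S))).
have := cl_sign_swap S T; rewrite exprD.
have := sqrr_sign R #|S :&: T|; have := sqrr_sign R (#|S| * #|T|)%N.
have -> : cl_sign T S * cl_sign T S = 1 by rewrite -expr2 sqrr_sign.
have : cl_sign S T * cl_sign S T = 1 by rewrite -expr2 sqrr_sign.
have : cl_sign T S * cl_sign T S = 1 by rewrite -expr2 sqrr_sign.
move: (cl_sign S T) (cl_sign T S) => x y; rewrite !expr2.
set p := _ ^+ (#|S| * _); set q := _ ^+ #|S :&: T| => yy xx pp qq xy.
move: ((-1) ^+ 'C(#|S|, 2)) ((-1) ^+ 'C(#|T|, 2)) => c d.
move: ((-1) ^+ 'C(#|symdiff S T|, 2)) => e.
rewrite !mulr1 => E; have {}E : c * d * p * q * x = e * x.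
  by rewrite E -[RHS]mul1r -qq; ring.
rewrite -E -[RHS]mul1r -xx.
transitivity (c * d * (p * q) * x); first ring.
by rewrite -xy; ring.
Qed.

Lemma cl_trM (a b : clifford) : cl_tr (a * b) = cl_tr b * cl_tr a.
Proof.
apply/ffunP=> U; rewrite !ffunE mulr_sumr.
rewrite [RHS](reindex_inj (inv_inj (symdiffK U))); apply: eq_bigr => S _ /=.
rewrite ![symdiff _ U]symdiffC symdiffK !ffunE.
have := cl_sign_tr S (symdiff U S); rewrite (symdiffC S) -symdiffA symdiffSS symdiff0.
by move=> E; rewrite !mulrA E; ring.
Qed.
End Clifford.

From mathcomp Require Import all_classical all_reals all_analysis complex.
Import numFieldNormedType.Exports.
Local Open Scope classical_set_scope.
Local Open Scope ring_scope.

Section Vahlen.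
Variables (R : realType) (n : nat).
Local Notation Cl := (clifford R n).

Inductive clifford_group : Cl -> Prop :=
| clifford_group_vec v : v != 0 -> clifford_group (cl_vec v)
| clifford_group1 : clifford_group 1
| clifford_groupM a b :
    clifford_group a -> clifford_group b -> clifford_group (a * b)
| clifford_groupV a : clifford_group a -> clifford_group a^-1.

Definition is_vec (a : Cl) : Prop := exists v, a = cl_vec v.

Definition SLGamma (A : 'M[Cl]_2) : Prop :=
  let: a := A 0 0 in let: b := A 0 1 in let: c := A 1 0 in let: d := A 1 1 in
  [/\ forall i j, A i j = 0 \/ clifford_group (A i j),
      is_vec (a * cl_tr c) /\ is_vec (b * cl_tr d),
      is_vec (cl_tr a * b) /\ is_vec (cl_tr c * d)
    & a * cl_tr d - b * cl_tr c = 1].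

(* Points of R^n with infinity added, infinity being None. *)
Definition sphere := option 'rV[R]_n.

(* The Clifford inverse is taken with the convention of unit rings, so the
   cases where the denominator vanishes are singled out; for A in SLGamma it is
   otherwise invertible and the quotients are vectors. *)
Definition mobius (A : 'M[Cl]_2) (x : sphere) : sphere :=
  if x is Some v then
    let den := A 1 0 * cl_vec v + A 1 1 in
    if den == 0 then None
    else Some (vec_part ((A 0 0 * cl_vec v + A 0 1) * den^-1))
  else if A 1 0 == 0 then None else Some (vec_part (A 0 0 * (A 1 0)^-1)).

Definition diag_part (A : 'M[Cl]_2) : 'M[Cl]_2 :=
  \matrix_(i, j) (if i == j then A i j else 0).
Definition offdiag_part (A : 'M[Cl]_2) : 'M[Cl]_2 :=
  \matrix_(i, j) (if i == j then 0 else A i j).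

Definition offdiag_mx (b c : Cl) : 'M[Cl]_2 :=
  \matrix_(i, j) (if i == j then 0 else if i == 0 then b else c).
End Vahlen.

Section RiemannSurface.
Variable R : realType.

Definition ex : R * R := (1, 0).
Definition ey : R * R := (0, 1).

Fixpoint Ck_on (k : nat) (U : set (R * R)) (h : R * R -> R) : Prop :=
  (forall z, U z -> {for z, continuous h}) /\
  if k is k'.+1 then
    (forall z, U z -> derivable h z ex /\ derivable h z ey) /\
    Ck_on k' U ('D_ex h) /\ Ck_on k' U ('D_ey h)
  else True.

Definition smooth_on U h := forall k, Ck_on k U h.

Definition toC (z : R * R) : R[i] := (z.1 +i* z.2)%C.
Definition ofC (w : R[i]) : R * R := (complex.Re w, complex.Im w).

(* h is complex differentiable at z, with complex derivative w. *)
Definition is_cderive (h : R * R -> R * R) (z : R * R) (w : R[i]) : Prop :=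
  is_diff z h (fun X => ofC (w * toC X)).

(* Charts take their values in the plane R * R; chart_inv is the inverse of the
   chart on its image chart_im, and is arbitrary elsewhere. *)
Record chart (M : topologicalType) := Chart {
  chart_dom : set M;
  chart_im : set (R * R);
  chart_map :> M -> R * R;
  chart_inv : R * R -> M;
  chart_dom_open : open chart_dom;
  chart_im_open : open chart_im;
  chart_mapP : forall p, chart_dom p -> chart_im (chart_map p);
  chart_invP : forall z, chart_im z -> chart_dom (chart_inv z);
  chart_mapK : forall p, chart_dom p -> chart_inv (chart_map p) = p;
  chart_invK : forall z, chart_im z -> chart_map (chart_inv z) = z;
  chart_map_cont : forall p, chart_dom p -> {for p, continuous chart_map};
  chart_inv_cont : forall z, chart_im z -> {for z, continuous chart_inv} }.

Definition transition (M : topologicalType) (c c' : chart M) : R * R -> R * R :=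
  fun z => c' (chart_inv c z).

Record riemann_surface (M : topologicalType) := RiemannSurface {
  atlas : set (chart M);
  atlas_cover : forall p, exists2 c, atlas c & chart_dom c p;
  atlas_holomorphic : forall c c' z, atlas c -> atlas c' ->
    chart_im c z -> chart_dom c' (chart_inv c z) ->
    exists w, is_cderive (transition c c') z w;
  surface_hausdorff : hausdorff_space M;
  surface_connected : connected [set: M] }.

Definition simply_connected (M : topologicalType) : Prop :=
  let I := `[0, 1]%classic : set R in
  (forall p q : M, exists gamma : R -> M,
    [/\ {within I, continuous gamma}, gamma 0 = p & gamma 1 = q]) /\
  (forall gamma : R -> M, {within I, continuous gamma} -> gamma 0 = gamma 1 ->
    exists H : R * R -> M,
    [/\ {within I `*` I, continuous H},
        forall t, I t -> H (0, t) = gamma t /\ H (1, t) = gamma 0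
      & forall s, I s -> H (s, 0) = gamma 0 /\ H (s, 1) = gamma 0]).

Variables (M : topologicalType) (S : riemann_surface M).

(* q c is the coefficient of dz^2 in the chart c. *)
Record quadratic_differential := QuadraticDifferential {
  qd_coef :> chart M -> R * R -> R[i];
  qd_holomorphic : forall c z, atlas S c -> chart_im c z ->
    exists w, is_cderive (fun z => ofC (qd_coef c z)) z w;
  qd_transition : forall c c' z w, atlas S c -> atlas S c' ->
    chart_im c z -> chart_dom c' (chart_inv c z) ->
    is_cderive (transition c c') z w ->
    qd_coef c z = qd_coef c' (transition c c' z) * w ^+ 2 }.

(* Being nonzero at p does not depend on the chart. *)
Definition qd_nonzero_at (Q : quadratic_differential) (p : M) : Prop :=
  exists c, [/\ atlas S c, chart_dom c p & Q c (c p) != 0].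

Definition polarisation (Q : quadratic_differential) : Prop :=
  exists p, qd_nonzero_at Q p.

Definition smooth (h : M -> R) : Prop :=
  forall c, atlas S c -> smooth_on (chart_im c) (fun z => h (chart_inv c z)).

(* The 1-form dh in the chart c, at the point of coordinate z, on the tangent
   vector of coordinates X. *)
Definition dform (h : M -> R) (c : chart M) (z X : R * R) : R :=
  X.1 * 'D_ex (fun z => h (chart_inv c z)) z +
  X.2 * 'D_ey (fun z => h (chart_inv c z)) z.

Variable n : nat.
Local Notation Cl := (clifford R n).

Definition vsmooth (f : M -> 'rV[R]_n) : Prop :=
  forall i, smooth (fun p => f p 0 i).
Definition vdform (f : M -> 'rV[R]_n) c z X : 'rV[R]_n :=
  \row_i dform (fun p => f p 0 i) c z X.

Definition mxsmooth (F : M -> 'M[Cl]_2) : Prop :=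
  forall i j (K : {set 'I_n}), smooth (fun p => F p i j K).
Definition mxdform (F : M -> 'M[Cl]_2) c z X : 'M[Cl]_2 :=
  \matrix_(i, j) [ffun K => dform (fun p => F p i j K) c z X].

Definition conformal_immersion_at (f : M -> 'rV[R]_n) (p : M) : Prop :=
  forall c, atlas S c -> chart_dom c p ->
  exists2 rho, 0 < rho & forall X Y,
    dot (vdform f c (c p) X) (vdform f c (c p) Y) =
    rho * (X.1 * Y.1 + X.2 * Y.2).

(* (alpha, beta)^{2,0} for d_z = (d_x - i d_y) / 2 and the complex bilinear
   extension of the inner product of R^n. *)
Definition pairing20 (alpha beta : R * R -> 'rV[R]_n) : R[i] :=
  ((dot (alpha ex) (beta ex) - dot (alpha ey) (beta ey)) / 4 +i*
   - ((dot (alpha ex) (beta ey) + dot (alpha ey) (beta ex)) / 4))%C.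

Definition christoffel (Q : quadratic_differential) (f fc : M -> 'rV[R]_n) : Prop :=
  [/\ vsmooth fc,
      forall c z X Y, atlas S c -> chart_im c z ->
        cl_vec (vdform f c z X) * cl_vec (vdform fc c z Y) -
        cl_vec (vdform f c z Y) * cl_vec (vdform fc c z X) = 0
    & forall c z, atlas S c -> chart_im c z ->
        pairing20 (vdform f c z) (vdform fc c z) = Q c z].

(* f, immersed on D, is isothermic with Christoffel transform fc. *)
Definition isothermic (D : set M) (Q : quadratic_differential)
    (f fc : M -> 'rV[R]_n) : Prop :=
  [/\ vsmooth f, forall p, D p -> conformal_immersion_at f p
    & christoffel Q f fc].

Definition darboux_solution (r : R) (f fc g : M -> 'rV[R]_n) : Prop :=
  [/\ vsmooth g, forall p, g p != 0
    & forall c z X, atlas S c -> chart_im c z ->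
      let gz := cl_vec (g (chart_inv c z)) in
      cl_vec (vdform g c z X) =
      r *: (gz * cl_vec (vdform fc c z X) * gz) - cl_vec (vdform f c z X)].

Definition darboux_transform (f g : M -> 'rV[R]_n) : M -> 'rV[R]_n :=
  fun p => f p + g p.

Definition darboux_christoffel (r : R) (fc g : M -> 'rV[R]_n) : M -> 'rV[R]_n :=
  fun p => fc p + vec_part (cl_vec (r *: g p))^-1.

Definition mx_form := chart M -> R * R -> R * R -> 'M[Cl]_2.

(* F : M -> SL(Gamma_n) with F^-1 dF = A, in the form dF = F A. *)
Definition is_frame_of (F : M -> 'M[Cl]_2) (A : mx_form) : Prop :=
  [/\ mxsmooth F, forall p, SLGamma (F p)
    & forall c z X, atlas S c -> chart_im c z ->
      mxdform F c z X = F (chart_inv c z) *m A c z X].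

(* h is one of the T-transforms T_s f, where f is isothermic with Christoffel
   transform fc away from the zeros of Q. *)
Definition T_transform (Q : quadratic_differential) (s : R)
    (f fc : M -> 'rV[R]_n) (h : M -> sphere R n) : Prop :=
  isothermic (qd_nonzero_at Q) Q f fc /\
  exists F,
    is_frame_of F (fun c z X =>
      offdiag_mx (cl_vec (vdform f c z X)) (s *: cl_vec (vdform fc c z X))) /\
    forall p, h p = mobius (F p) (Some 0).

(* (h, hhat) is a member of parameter lam of the associated family of the pair
   (f, fhat). *)
Definition associated_family (lam : R) (f fhat : M -> 'rV[R]_n)
    (h hhat : M -> sphere R n) : Prop :=
  exists F A Flam,
    [/\ is_frame_of F A,
        forall p, mobius (F p) (Some 0) = Some (f p) /\
                  mobius (F p) None = Some (fhat p),
        is_frame_of Flam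
          (fun c z X => diag_part (A c z X) + (lam%:A) *: offdiag_part (A c z X))
      & forall p, h p = mobius (Flam p) (Some 0) /\
                  hhat p = mobius (Flam p) None].

Definition mobius_equivalent (h h' : M -> sphere R n) : Prop :=
  exists2 B, SLGamma B & forall p, h p = mobius B (h' p).
End RiemannSurface.

(* Main.v *)
(* Let F = (a b; c d) be a frame of the pair (f, f + g), so that b = f d and
   a = (f + g) c.  Differentiating these relations and u c d^t = 1, u = g in the
   Clifford algebra, determines the form F^-1 dF up to its diagonal part:
     A_p = (0  d^t df d; - c^t (df + dg) c  0).
   Right multiplication of F_lam by the lower triangular matrix
     P = (d^t D  0; - lam^-1 c^t D  N^-1 c^t u D)
   leaves F_lam . 0 unchanged and turns A_k + lam A_p into
   (0 df; (1 - lam^2) r df^c 0); here D is a constant of the Clifford group with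
   D v D^t = lam v for all vectors v, and N = D D^t.  Hence f_(lam) is a
   T-transform of f.  It is unique modulo Moebius transformations because two
   frames with the same form differ by a constant left factor, M being connected
   and the Vahlen matrices being a group acting on the sphere.
   The second half follows by exchanging 0 and infinity: (f + g, f) is again a
   Darboux pair of parameter r, with - g in place of g. *)
From HB Require Import structures.
Require Import Defs.
From mathcomp Require Import all_boot all_order all_algebra.
From mathcomp Require Import all_classical all_reals all_analysis complex.
From mathcomp Require Import ring lra.
Import Order.TTheory GRing.Theory Num.Theory.
Import numFieldNormedType.Exports.
Local Open Scope ring_scope.

Set Implicit Arguments.
Unset Strict Implicit.
Unset Printing Implicit Defensive.

Local Notation "a ^t" := (cl_tr a) (at level 8, format "a ^t").

(** * Clifford group and Vahlen matrices *)

Section CliffordLinear.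
Context {R : fieldType} {n : nat}.
Local Notation Cl := (clifford R n).

(** The matrix [P] comes from lambda = 1. There F itself serves as F_lam, the parameter (1 -
    lambda^2) r is 0, and the translation matrix (1 f; 0 1) is a frame for T_0 f = f. Since b = f d
    and a = (f + g) c, the quotient F^-1 (1 f; 0 1) equals (d^t 0; - c^t c^t g), which is [P] with
    lambda = D = N = 1. For general lambda, dividing the lower left entry by lambda clears the
    diagonal of the gauged form, while the constant D absorbs the factor lambda in lambda df; the
    lower left entry of the form then carries lambda^-1 - lambda, and passing D across df^c makes it
    1 - lambda^2. Two obstacles shape the rest. The set of entries allowed in a Vahlen matrix is not
    closed under addition, so that products stay Vahlen has to be derived from the vector
    conditions. And a T-transform of fhat requires fhat to be isothermic away from the zeros of Q,
    which rests on f^c being conformal there. *)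

Lemma cl_tr_is_linear : linear (@cl_tr R n).
Proof.
move=> k a b; apply/ffunP=> K; rewrite !ffunE mulrDr; congr (_ + _).
by rewrite /GRing.scale /= mulrCA.
Qed.
HB.instance Definition _ :=
  GRing.isLinear.Build R Cl Cl *:%R (@cl_tr R n) cl_tr_is_linear.

Lemma cl_vec_is_linear : linear (@cl_vec R n).
Proof.
move=> k v w; rewrite !cl_vecE scaler_sumr -big_split; apply: eq_bigr => i _.
by rewrite !mxE scalerDl scalerA.
Qed.
HB.instance Definition _ :=
  GRing.isLinear.Build R 'rV[R]_n Cl *:%R (@cl_vec R n) cl_vec_is_linear.

Lemma cl_trD : {morph @cl_tr R n : a b / a + b}.
Proof. exact: linearD. Qed.

Lemma cl_trN : {morph @cl_tr R n : a / - a}.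
Proof. exact: linearN. Qed.

Lemma cl_tr1 : (1 : Cl)^t = 1.
Proof.
by have := cl_trM (1 : Cl) ((1 : Cl)^t); rewrite mul1r cl_trK mul1r => <-.
Qed.

Lemma dotC (v w : 'rV[R]_n) : dot v w = dot w v.
Proof. by apply: eq_bigr => i _; rewrite mulrC. Qed.

Lemma dotZl k (v w : 'rV[R]_n) : dot (k *: v) w = k * dot v w.
Proof. by rewrite mulr_sumr; apply: eq_bigr => i _; rewrite mxE mulrA. Qed.

Lemma dot0l (v : 'rV[R]_n) : dot 0 v = 0.
Proof. by rewrite /dot big1 // => i _; rewrite mxE mul0r. Qed.

End CliffordLinear.

Section CliffordGroup.
Context {R : realType} {n : nat}.
Local Notation Cl := (clifford R n).
Implicit Types (a b c d p q x y v : Cl) (k : R) (A B : 'M[Cl]_2).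

Lemma dot_eq0 (v : 'rV[R]_n) : (dot v v == 0) = (v == 0).
Proof.
rewrite psumr_eq0 => [|i _]; last by rewrite -expr2 sqr_ge0.
apply/allP/eqP => [v0|-> i _]; last by rewrite mxE mulr0 eqxx.
apply/rowP=> i; apply/eqP; rewrite mxE.
by have := v0 i (mem_index_enum _); rewrite mulf_eq0 orbb.
Qed.

Lemma cl_vec_sqr (v : 'rV[R]_n) : cl_vec v * cl_vec v = - (dot v v)%:A.
Proof.
have := cl_vec_comm v v; rewrite -mulr2n -scaler_nat -scalerA -scalerN.
by apply: scalerI; rewrite pnatr_eq0.
Qed.

Lemma is_vec_cl_vec (v : 'rV[R]_n) : is_vec (cl_vec v).
Proof. by exists v. Qed.

Lemma is_vec0 : is_vec (0 : Cl).
Proof. by exists 0; rewrite linear0. Qed.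

Lemma is_vecD a b : is_vec a -> is_vec b -> is_vec (a + b).
Proof. by move=> [v ->] [w ->]; exists (v + w); rewrite linearD. Qed.

Lemma is_vecZ k a : is_vec a -> is_vec (k *: a).
Proof. by move=> [v ->]; exists (k *: v); rewrite linearZ. Qed.

Lemma is_vecN a : is_vec a -> is_vec (- a).
Proof. by rewrite -scaleN1r; exact: is_vecZ. Qed.

Lemma is_vecZ_inv k a : k != 0 -> is_vec (k *: a) -> is_vec a.
Proof. by move=> k0 /(is_vecZ k^-1); rewrite scalerA mulVf // scale1r. Qed.

Lemma is_vec_tr a : is_vec a -> a^t = a.
Proof. by move=> [v ->]; rewrite cl_tr_vec. Qed.

Lemma vec_partK a : is_vec a -> cl_vec (vec_part a) = a.
Proof. by move=> [v ->]; rewrite cl_vecK. Qed.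

Lemma is_vec_trE a : is_vec a^t -> is_vec a.
Proof. by move=> va; rewrite -[a]cl_trK is_vec_tr. Qed.

Lemma is_vec_comm a b : is_vec a -> is_vec b -> exists k, a * b + b * a = k%:A.
Proof. by move=> [v ->] [w ->]; rewrite cl_vec_comm -scaleNr; eexists. Qed.

Lemma is_vec_sqr a : is_vec a -> exists k, a * a = k%:A.
Proof. by move=> [v ->]; rewrite cl_vec_sqr -scaleNr; eexists. Qed.

(** Since [a * b + b * a] and [a * a] are scalars, moving one [a] past [b] leaves a combination of
    [a] and [b]. *)
Lemma is_vec_sandwich a b : is_vec a -> is_vec b -> is_vec (a * b * a).
Proof.
move=> va vb; have [k abE] := is_vec_comm va vb; have [l aaE] := is_vec_sqr va.
have -> : a * b * a = k *: a - l *: b.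
  by rewrite -[a * b](addrK (b * a)) abE mulrBl mulr_algl -mulrA aaE mulr_algr.
by apply: is_vecD; [exact: is_vecZ|apply: is_vecN; exact: is_vecZ].
Qed.

(* The elements a of the Clifford group act on R^n by the similarities
   v |-> a v a^t. *)
Definition similitude a := exists2 N : R, N != 0 &
  [/\ a * a^t = N%:A, a^t * a = N%:A
    & forall v, is_vec v -> is_vec (a * v * a^t) /\ is_vec (a^t * v * a)].

Lemma mulr1_eq_invr a b : a * b = 1 -> b * a = 1 -> a \is a GRing.unit /\ a^-1 = b.
Proof.
move=> ab ba; have ua : a \is a GRing.unit by apply/unitrP; exists b.
by split=> //; rewrite -[RHS](mulKr ua) ab mulr1.
Qed.

Lemma similitudeV_eq a N : N != 0 -> a * a^t = N%:A -> a^t * a = N%:A ->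
  a \is a GRing.unit /\ a^-1 = N^-1 *: a^t.
Proof.
move=> N0 aa ta; apply: mulr1_eq_invr.
  by rewrite -scalerAr aa scalerA mulVf // scale1r.
by rewrite -scalerAl ta scalerA mulVf // scale1r.
Qed.

Lemma similitude1 : similitude 1.
Proof.
exists 1; rewrite ?oner_neq0 // cl_tr1 scale1r; split; rewrite ?mulr1 // => v.
by rewrite mul1r mulr1.
Qed.

Lemma similitude_vec (v : 'rV[R]_n) : v != 0 -> similitude (cl_vec v).
Proof.
move=> v0; exists (- dot v v); first by rewrite oppr_eq0 dot_eq0.
rewrite cl_tr_vec cl_vec_sqr scaleNr; split=> // w vw.
by split; exact: is_vec_sandwich (is_vec_cl_vec _) _.
Qed.

Lemma similitudeM a b : similitude a -> similitude b -> similitude (a * b).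
Proof.
move=> [N N0 [aa ta va]] [L L0 [bb tb vb]]; exists (N * L).
  by rewrite mulf_neq0.
rewrite cl_trM; split=> [||v vv].
- by rewrite mulrA -(mulrA a) bb mulr_algr -scalerAl aa scalerA mulrC.
- by rewrite mulrA -(mulrA _ _ a) ta mulr_algr -scalerAl tb scalerA.
split.
  have -> : a * b * v * (b^t * a^t) = a * (b * v * b^t) * a^t by rewrite !mulrA.
  by case: (va (b * v * b^t)) => //; case: (vb v).
have -> : b^t * a^t * v * (a * b) = b^t * (a^t * v * a) * b by rewrite !mulrA.
by case: (vb (a^t * v * a)) => //; case: (va v).
Qed.

Lemma similitude_tr a : similitude a -> similitude a^t.
Proof.
move=> [N N0 [aa ta va]]; exists N => //; rewrite cl_trK; split=> // v vv.
by case: (va v).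
Qed.

Lemma similitudeZ k a : k != 0 -> similitude a -> similitude (k *: a).
Proof.
move=> k0 [N N0 [aa ta va]]; exists (k * k * N); first by rewrite !mulf_neq0.
rewrite linearZ /=; split=> [||v vv].
- by rewrite -scalerAl -scalerAr aa !scalerA.
- by rewrite -scalerAl -scalerAr ta !scalerA.
have [vl vr] := va v vv.
by rewrite -!(scalerAl, scalerAr); split; do 2 apply: is_vecZ.
Qed.

Lemma clifford_group_similitude a : clifford_group a -> similitude a.
Proof.
elim=> [v v0||b c _ sb _ sc|b _ sb]; first exact: similitude_vec.
- exact: similitude1.
- exact: similitudeM.
case: (sb) => N N0 [bb tb _]; have [_ ->] := similitudeV_eq N0 bb tb.
by apply: similitudeZ; [rewrite invr_eq0|exact: similitude_tr].
Qed.

Lemma clifford_group_unit a : clifford_group a -> a \is a GRing.unit.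
Proof.
by move=> /clifford_group_similitude[N N0 [aa ta _]]; have [] := similitudeV_eq N0 aa ta.
Qed.

Lemma clifford_group_tr a : clifford_group a -> clifford_group a^t.
Proof.
elim=> [v v0||b c _ gb _ gc|b gb gtb].
- by rewrite cl_tr_vec; constructor.
- by rewrite cl_tr1; constructor.
- by rewrite cl_trM; apply: clifford_groupM.
suff -> : (b^-1)^t = (b^t)^-1 by constructor.
have ub := clifford_group_unit gb.
have [//||_ ->//] := @mulr1_eq_invr b^t (b^-1)^t; rewrite -cl_trM.
  by rewrite mulVr // cl_tr1.
by rewrite mulrV // cl_tr1.
Qed.

(** A nonzero scalar is the product of two multiples of one unit vector, which exists in positive
    dimension. *)
Lemma clifford_groupZ k a : (0 < n)%N -> k != 0 -> clifford_group a ->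
  clifford_group (k *: a).
Proof.
move=> n0 k0 ga; pose e : 'rV[R]_n := delta_mx 0 (Ordinal n0).
have e0 : e != 0.
  apply/eqP => /rowP/(_ (Ordinal n0)); rewrite !mxE !eqxx => /eqP.
  by rewrite oner_eq0.
have -> : k *: a = cl_vec ((- k / dot e e) *: e) * cl_vec e * a.
  rewrite linearZ /= -scalerAl cl_vec_sqr scalerN scalerA -mulrA mulVf ?dot_eq0 //.
  by rewrite mulr1 scaleNr opprK mulr_algl.
apply: clifford_groupM => //; apply: clifford_groupM; constructor => //.
by rewrite scaler_eq0 negb_or e0 andbT mulf_neq0 ?invr_eq0 ?dot_eq0 // oppr_eq0.
Qed.

Definition clifford0 a := a = 0 \/ clifford_group a.

Lemma clifford0M a b : clifford0 a -> clifford0 b -> clifford0 (a * b).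
Proof.
move=> [->|ga] [->|gb]; rewrite ?mulr0 ?mul0r; try by left.
by right; apply: clifford_groupM.
Qed.

Lemma clifford0_tr a : clifford0 a -> clifford0 a^t.
Proof.
by move=> [->|ga]; [left; rewrite linear0|right; exact: clifford_group_tr].
Qed.

Lemma clifford0Z k a : (0 < n)%N -> clifford0 a -> clifford0 (k *: a).
Proof.
move=> n0 [->|ga]; first by rewrite scaler0; left.
by have [->|k0] := eqVneq k 0; [left; rewrite scale0r|right; apply: clifford_groupZ].
Qed.

Lemma clifford0_neq0 a : clifford0 a -> a != 0 -> clifford_group a.
Proof. by case=> // ->; rewrite eqxx. Qed.

Lemma is_vec_clifford0 a : is_vec a -> clifford0 a.
Proof.
move=> [v ->]; have [->|v0] := eqVneq v 0; first by left; rewrite linear0.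
by right; constructor.
Qed.

(** The vector a b^t equals its transpose b a^t, and sandwiching the latter between a^t and a gives
    a scalar multiple of a^t b. *)
Lemma is_vec_swap a b : clifford0 a -> is_vec (a * b^t) -> is_vec (a^t * b).
Proof.
move=> [-> _|/clifford_group_similitude[N N0 [_ ta va]] vab].
  by rewrite linear0 mul0r; exact: is_vec0.
apply: (is_vecZ_inv N0); have [_] := va _ vab.
by rewrite -{1}(is_vec_tr vab) cl_trM cl_trK -!mulrA ta mulr_algr -scalerAr.
Qed.

Lemma is_vec_swap_tr a b : clifford0 a -> is_vec (a^t * b) -> is_vec (a * b^t).
Proof.
move=> ga; rewrite -{1}[b]cl_trK => /(is_vec_swap (clifford0_tr ga)).
by rewrite cl_trK.
Qed.

(* If a and q are nonzero then a p + b q = a (p q^-1 + a^-1 b) q, where the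
   middle factor is a vector. *)
Lemma clifford0_comb a b p q : clifford0 a -> clifford0 b -> clifford0 p ->
  clifford0 q -> is_vec (a^t * b) -> is_vec (p * q^t) -> clifford0 (a * p + b * q).
Proof.
move=> ga gb gp gq vab vpq.
case: (ga) => [->|/clifford_group_similitude[N N0 [aa _ _]]].
  by rewrite mul0r add0r; exact: clifford0M.
case: (gq) => [->|/clifford_group_similitude[L L0 [_ tq _]]].
  by rewrite mulr0 addr0; exact: clifford0M.
have -> : a * p + b * q = a * (L^-1 *: (p * q^t) + N^-1 *: (a^t * b)) * q.
  rewrite mulrDr mulrDl -!scalerAr -!scalerAl !mulrA aa -!mulrA tq mulr_algr.
  by rewrite mulr_algl -!(scalerAr, scalerAl) !scalerA !mulVf // !scale1r.
apply: clifford0M => //; apply: clifford0M => //; apply: is_vec_clifford0.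
by apply: is_vecD; apply: is_vecZ.
Qed.

(** * Vahlen matrices as quadruples of entries, their group structure and their action *)

Definition vahlen a b c d :=
  [/\ [/\ clifford0 a, clifford0 b, clifford0 c & clifford0 d],
      is_vec (a * c^t) /\ is_vec (b * d^t),
      is_vec (a^t * b) /\ is_vec (c^t * d)
    & a * d^t - b * c^t = 1].

(** The degenerate case a = 0 of the identities below, whose general proofs cancel the scalar a a^t.
    The determinant then makes b invertible and c^t = - b^-1. *)
Lemma vahlen_a0 b c : clifford0 b -> - (b * c^t) = 1 ->
  exists N, [/\ N != 0, b * b^t = N%:A, b^t * b = N%:A,
   c^t = - N^-1 *: b^t & forall v, is_vec v -> is_vec (b * v * b^t)].
Proof.
move=> [->|/clifford_group_similitude[N N0 [bb tb vb]]] bc.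
  by move: bc; rewrite mul0r oppr0 => /eqP; rewrite eq_sym oner_eq0.
exists N; split=> [||||v /vb[]] //.
apply: (scalerI N0); rewrite -mulr_algl -tb -mulrA -[b * _]opprK bc.
by rewrite mulrN1 scalerA mulrN mulfV // scaleN1r.
Qed.

(** After multiplication by N = a^t a, the transposed determinant d a^t = 1 + c b^t can be
    substituted; the remaining terms cancel because a^t b and a^t c are their own transposes. This
    is what makes the right inverse of a Vahlen matrix a left inverse. *)
Lemma vahlen_dual a b c d : vahlen a b c d -> a^t * d - c^t * b = 1.
Proof.
move=> [[ga gb gc gd] [vac vbd] [vab vcd] det].
have [a0|a0] := eqVneq a 0.
  move: det; rewrite a0 linear0 !mul0r !sub0r => /(vahlen_a0 gb)[N [N0 _ tb -> _]].
  by rewrite -scalerAl tb scalerA mulNr mulVf // scaleN1r opprK.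
have /clifford_group_similitude[N N0 [aa ta _]] := clifford0_neq0 ga a0.
apply: (scalerI N0).
have tac : a^t * c = c^t * a.
  by rewrite -[LHS]is_vec_tr ?cl_trM ?cl_trK //; exact: is_vec_swap.
have tab : a^t * b = b^t * a by rewrite -[LHS]is_vec_tr // cl_trM cl_trK.
have /(congr1 (@cl_tr R n)) := det; rewrite linearB /= !cl_trM !cl_trK cl_tr1 => dett.
have {}dett : d * a^t = 1 + c * b^t by rewrite -dett subrK.
rewrite scalerBr; have -> : N *: (a^t * d) = a^t * (d * a^t) * a.
  by rewrite -!mulrA ta !mulr_algr -scalerAr.
have -> : N *: (c^t * b) = c^t * a * (a^t * b).
  by rewrite -!mulrA (mulrA a) aa mulr_algl -scalerAr.
by rewrite dett mulrDr mulr1 mulrDl ta !mulrA tac -(mulrA _ _ a) -tab !mulrA addrK.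
Qed.

(** These are the mixed terms of (a x + b y) (c x + d y)^t for v = x y^t. Multiplied by N = a^t a,
    with a d^t = 1 + b c^t, they become a v a^t plus a (v w + w v) c^t for the vector w = a^t b, and
    the anticommutator is a scalar. *)
Lemma vahlen_sandwich a b c d v : vahlen a b c d -> is_vec v ->
  is_vec (a * v * d^t + b * v * c^t).
Proof.
move=> [[ga gb gc gd] [vac vbd] [vab vcd] det] vv.
have [a0|a0] := eqVneq a 0.
  move: det; rewrite a0 !mul0r !sub0r add0r => /(vahlen_a0 gb)[N [N0 _ _ -> sb]].
  by rewrite -scalerAr; apply: is_vecZ; exact: sb.
have /clifford_group_similitude[N N0 [aa ta sa]] := clifford0_neq0 ga a0.
have [k kE] := is_vec_comm vv vab; apply: (is_vecZ_inv N0).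
suff -> : N *: (a * v * d^t + b * v * c^t) = a * v * a^t + k *: (a * c^t).
  by apply: is_vecD; [case: (sa v)|exact: is_vecZ].
have adE : a * d^t = 1 + b * c^t by rewrite -det subrK.
have -> : k *: (a * c^t) = a * (v * (a^t * b) + a^t * b * v) * c^t.
  by rewrite kE mulr_algr -scalerAl.
rewrite scalerDr mulrDr mulrDl addrA; congr (_ + _).
  have -> : N *: (a * v * d^t) = a * v * a^t * (a * d^t).
    by rewrite !mulrA -(mulrA _ _ a) ta mulr_algr -scalerAl.
  by rewrite adE mulrDr mulr1 !mulrA.
by rewrite !mulrA aa mulr_algl -!scalerAl.
Qed.

Lemma vahlen_tr a b c d : vahlen a b c d -> vahlen a^t c^t b^t d^t.
Proof.
move=> V; have D := vahlen_dual V.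
case: V => [[ga gb gc gd] [vac vbd] [vab vcd] det].
by split; rewrite ?cl_trK //; split; exact: clifford0_tr.
Qed.

Lemma vahlen_adj a b c d : (0 < n)%N -> vahlen a b c d ->
  vahlen d^t (- b^t) (- c^t) a^t.
Proof.
move=> n0 V; have D := vahlen_dual V.
case: V => [[ga gb gc gd] [vac vbd] [vab vcd] det].
split; rewrite ?linearN /= ?cl_trK ?mulNr ?mulrN ?opprK.
- by split; try exact: clifford0_tr; rewrite -scaleN1r;
    apply: clifford0Z => //; exact: clifford0_tr.
- by split; apply: is_vecN; apply: is_vec_trE; rewrite cl_trM cl_trK.
- by split; apply: is_vecN; apply: is_vec_trE; rewrite cl_trM cl_trK.
- by rewrite -cl_tr1 -D linearB /= !cl_trM !cl_trK.
Qed.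

(** As x x^t and y y^t are scalars, the pure terms of the expansion are multiples of a c^t and b
    d^t; the mixed terms are those of [vahlen_sandwich]. *)
Lemma vahlen_cols a b c d x y : vahlen a b c d -> clifford0 x -> clifford0 y ->
  is_vec (x * y^t) -> is_vec ((a * x + b * y) * (c * x + d * y)^t).
Proof.
move=> V; case: (V) => [[ga gb gc gd] [vac vbd] [vab vcd] det] gx gy vxy.
have scal z : clifford0 z -> exists k, z * z^t = k%:A.
  by move=> [->|/clifford_group_similitude[k _ [-> _ _]]];
    [exists 0; rewrite mul0r scale0r|exists k].
rewrite linearD /= !cl_trM mulrDl !mulrDr.
have [k kE] := scal _ gx; have [l lE] := scal _ gy.
rewrite -!mulrA (mulrA x) kE (mulrA y y^t) lE (mulrA x) (mulrA y).
have -> : y * x^t = x * y^t by rewrite -[RHS](is_vec_tr vxy) cl_trM cl_trK.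
rewrite !mulr_algl -!scalerAr [X in _ + X]addrC addrACA; apply: is_vecD.
  by apply: is_vecD; apply: is_vecZ.
by have := vahlen_sandwich V vxy; rewrite !mulrA.
Qed.

Definition mx2 a b c d : 'M[Cl]_2 :=
  \matrix_(i, j) if i == 0 then if j == 0 then a else b
                 else if j == 0 then c else d.

Lemma mx2E a b c d : (mx2 a b c d 0 0 = a) * (mx2 a b c d 0 1 = b) *
  (mx2 a b c d 1 0 = c) * (mx2 a b c d 1 1 = d).
Proof. by rewrite !mxE. Qed.

Lemma ord2P (P : 'I_2 -> Prop) : P 0 -> P 1 -> forall i, P i.
Proof.
move=> P0 P1 [[|[|//]] lt_i].
  by rewrite (_ : Ordinal _ = 0) //; exact: val_inj.
by rewrite (_ : Ordinal _ = 1) //; exact: val_inj.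
Qed.

Lemma mx2P (A B : 'M[Cl]_2) : A 0 0 = B 0 0 -> A 0 1 = B 0 1 ->
  A 1 0 = B 1 0 -> A 1 1 = B 1 1 -> A = B.
Proof.
move=> h00 h01 h10 h11; apply/matrixP => i; move: i.
by apply: ord2P => j; move: j; apply: ord2P.
Qed.

Lemma mulmx2E (A B : 'M[Cl]_2) i j : (A *m B) i j = A i 0 * B 0 j + A i 1 * B 1 j.
Proof.
rewrite mxE big_ord_recl big_ord1; congr (_ + A i _ * B _ j); exact: val_inj.
Qed.

Lemma SLGammaE (A : 'M[Cl]_2) :
  SLGamma A <-> vahlen (A 0 0) (A 0 1) (A 1 0) (A 1 1).
Proof.
split=> [[gA ac ab det]|[[ga gb gc gd] ac ab det]]; first by split; [split; exact: gA|..].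
by split=> // i; move: i; apply: ord2P => j; move: j; apply: ord2P.
Qed.

(** The Clifford analogue of the adjugate. Being additive and defined on all matrices, it applies to
    matrix-valued forms too and commutes with differentiation. *)
Definition vadj (A : 'M[Cl]_2) : 'M[Cl]_2 :=
  mx2 (A 1 1)^t (- (A 0 1)^t) (- (A 1 0)^t) (A 0 0)^t.

Lemma vadjM A B : vadj (A *m B) = vadj B *m vadj A.
Proof.
by apply: mx2P; rewrite !(mulmx2E, mx2E) cl_trD !cl_trM ?mulrNN ?mulNr ?mulrN
  -?opprD 1?addrC.
Qed.

Lemma SLGamma_mul_vadj A : SLGamma A -> A *m vadj A = 1%:M.
Proof.
move=> /SLGammaE V; have D := vahlen_dual V.
case: V => [[ga gb gc gd] [vac vbd] [vab vcd] det].
apply: mx2P; rewrite mulmx2E !mx2E !mxE /= ?mulrN.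
- exact: det.
- rewrite -(is_vec_tr (is_vec_swap_tr ga vab)) cl_trM cl_trK.
  by rewrite addNr.
- rewrite -(is_vec_tr (is_vec_swap_tr gc vcd)) cl_trM cl_trK.
  by rewrite subrr.
- by rewrite -[1%:R]cl_tr1 -det linearB /= !cl_trM !cl_trK addrC.
Qed.

Lemma SLGamma_vadj_mul A : SLGamma A -> vadj A *m A = 1%:M.
Proof.
move=> /SLGammaE V; have D := vahlen_dual V.
case: V => [[ga gb gc gd] [vac vbd] [vab vcd] det].
apply: mx2P; rewrite mulmx2E !mx2E !mxE /= ?mulNr.
- by rewrite -[1%:R]cl_tr1 -D linearB /= !cl_trM !cl_trK.
- rewrite -(is_vec_tr (is_vec_swap gb vbd)) cl_trM cl_trK.
  by rewrite subrr.
- rewrite -(is_vec_tr (is_vec_swap ga vac)) cl_trM cl_trK.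
  by rewrite addNr.
- by rewrite addrC.
Qed.

Lemma SLGammaV A : (0 < n)%N -> SLGamma A -> SLGamma (vadj A).
Proof.
by move=> n0 /SLGammaE V; apply/SLGammaE; rewrite !mx2E; exact: vahlen_adj.
Qed.

Lemma SLGammaM A B : SLGamma A -> SLGamma B -> SLGamma (A *m B).
Proof.
move=> sA sB; have := SLGamma_mul_vadj sB.
(* The determinant condition for the product is the upper left entry of (A B) vadj(A B) = 1. *)
move=> /(congr1 (fun X => A *m X *m vadj A)).
rewrite mulmx1 (SLGamma_mul_vadj sA) !mulmxA -(mulmxA _ (vadj B)) -vadjM.
move=> /matrixP/(_ 0 0).
rewrite mulmx2E !mx2E => det.
move/SLGammaE: sA => V; move/SLGammaE: sB => V'.
have VT := vahlen_tr V'.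
case: (V) => [[ga gb gc gd] [vac vbd] [vab vcd] _].
case: (V') => [[ga' gb' gc' gd'] [vac' vbd'] [vab' vcd'] _].
apply/SLGammaE; split; last by move: det; rewrite mulrN !mxE eqxx.
- by rewrite !mulmx2E; split; apply: clifford0_comb.
- by rewrite !mulmx2E; split; apply: vahlen_cols.
(* The conditions on rows are the conditions on columns for the transposed product, whose left
   factor is covered by [vahlen_tr]. *)
- rewrite !mulmx2E; split.
    have := vahlen_cols VT (clifford0_tr ga) (clifford0_tr gb).
    by rewrite !cl_trK -!cl_trM -!cl_trD cl_trK; apply.
  have := vahlen_cols VT (clifford0_tr gc) (clifford0_tr gd).
  by rewrite !cl_trK -!cl_trM -!cl_trD cl_trK; apply.
Qed.

Lemma clifford0_mulIr a b : clifford_group b -> (a * b == 0) = (a == 0).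
Proof.
move=> /clifford_group_unit ub; apply/eqP/eqP => [ab|->]; last exact: mul0r.
by rewrite -[a](mulrK ub) ab mul0r.
Qed.

(* b d^-1 = L^-1 b d^t for L = d^t d. *)
Lemma is_vec_div b d : clifford_group d -> is_vec (b * d^t) -> is_vec (b * d^-1).
Proof.
move=> /clifford_group_similitude[N N0 [dd td _]] vbd.
have [_ ->] := similitudeV_eq N0 dd td.
by rewrite -scalerAr; exact: is_vecZ.
Qed.

(** The base point 0 is enough: all transforms are given as images of 0 under frames, and images of
    infinity are reduced to it by the exchange matrix. The two cases below are B . 0 infinite and B
    . 0 finite. *)
Lemma mobius_mul0 A B : SLGamma A -> SLGamma B ->
  mobius (A *m B) (Some 0) = mobius A (mobius B (Some 0)).
Proof.
move=> sA sB; have /SLGammaE[[_ _ _]] := SLGammaM sA sB.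
move/SLGammaE: sA => [[_ _ gc _] _ _ _].
move/SLGammaE: sB => [[_ gb _ gd] [_ vbd] _ det].
rewrite /mobius linear0 !mulr0 !add0r !mulmx2E => gM _ _ _.
case: (eqVneq (B 1 1) 0) => [d0|d0] /=.
  have {}gb : clifford_group (B 0 1).
    apply: clifford0_neq0 => //; apply: contra_eq_neq det => ->.
    by rewrite d0 linear0 mulr0 mul0r subr0 eq_sym oner_neq0.
  rewrite d0 !mulr0 !addr0 clifford0_mulIr //; case: eqP => // /eqP c0.
  have uc := clifford_group_unit (clifford0_neq0 gc c0).
  have ub := clifford_group_unit gb.
  by rewrite invrM // mulrA mulrK.
have {}gd := clifford0_neq0 gd d0; have ud := clifford_group_unit gd.
rewrite vec_partK; last exact: is_vec_div.
have E i : A i 0 * B 0 1 + A i 1 * B 1 1 = (A i 0 * (B 0 1 / B 1 1) + A i 1) * B 1 1.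
  by rewrite mulrDl -!mulrA mulVr // mulr1.
move: gM; rewrite !E clifford0_mulIr //; case: eqP => // /eqP den0 gM.
have /clifford_group_unit : clifford_group ((A 1 0 * (B 0 1 / B 1 1) + A 1 1) * B 1 1).
  by apply: clifford0_neq0; rewrite ?clifford0_mulIr.
rewrite (unitrMl _ ud); move: (A 0 0 * _ + _) (A 1 0 * _ + _) => num den uden.
by rewrite (invrM uden ud) mulrA (mulrK ud).
Qed.
End CliffordGroup.

Local Open Scope classical_set_scope.

(** * Smooth functions and forms on a Riemann surface *)

Section PlaneCalculus.
Context {R : realType}.
Implicit Types (U : set (R * R)) (h l : R * R -> R) (v x z : R * R).

Lemma Ck_onSE k U h : Ck_on k.+1 U h <->
  [/\ forall z, U z -> {for z, continuous h},
      forall z, U z -> derivable h z (ex R) /\ derivable h z (ey R),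
      Ck_on k U ('D_(ex R) h) & Ck_on k U ('D_(ey R) h)].
Proof.
split=> [[ch [dh [hx hy]]]|[ch dh hx hy]]; first exact: And4.
exact: conj ch (conj dh (conj hx hy)).
Qed.

Lemma Ck_on0E U h : Ck_on 0 U h <-> forall z, U z -> {for z, continuous h}.
Proof. by split=> [[]|] //; exact: conj. Qed.

(** The product rule leaves one factor undifferentiated, so the inductions for products and inverses
    use each factor at one order less. *)
Lemma Ck_on_le1 k U h : Ck_on k.+1 U h -> Ck_on k U h.
Proof.
elim: k h => [|k IHk] h /Ck_onSE[ch dh hx hy]; first exact/Ck_on0E.
by apply/Ck_onSE; exact: And4 ch dh (IHk _ hx) (IHk _ hy).
Qed.

Section OpenSet.
Variable U : set (R * R).
Hypothesis oU : open U.

Lemma open_near_eq h l z : {in U, h =1 l} -> U z -> {near z, h =1 l}.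
Proof.
move=> hl Uz; have : nbhs z U by exact: open_nbhs_nbhs.
by apply: filterS => w Uw; apply: hl; rewrite inE.
Qed.

Lemma open_eq_derivable h l z v :
  {in U, h =1 l} -> U z -> derivable h z v -> derivable l z v.
Proof. by move=> hl Uz; apply: near_eq_derivable; exact: open_near_eq. Qed.

Lemma open_eq_derive h l z v :
  {in U, h =1 l} -> U z -> 'D_v h z = 'D_v l z.
Proof. by move=> hl Uz; apply: near_eq_derive; exact: open_near_eq. Qed.

Lemma open_eq_continuous h l z :
  {in U, h =1 l} -> U z -> {for z, continuous h} -> {for z, continuous l}.
Proof.
move=> hl Uz ch; rewrite /prop_for /continuous_at -hl ?inE //; apply: cvg_trans ch.
by apply: near_eq_cvg; apply: filterS (open_near_eq hl Uz) => w ->.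
Qed.

Lemma Ck_on_eq k h l : {in U, h =1 l} -> Ck_on k U h -> Ck_on k U l.
Proof.
elim: k h l => [|k IHk] h l hl.
  by move=> [ch _]; split=> // z Uz; exact: open_eq_continuous (ch z Uz).
move=> /Ck_onSE[ch dh hx hy]; apply/Ck_onSE; split.
- by move=> z Uz; exact: open_eq_continuous (ch z Uz).
- by move=> z Uz; have [] := dh z Uz; split; exact: open_eq_derivable hl Uz _.
- by apply: IHk hx => z /set_mem Uz; exact: open_eq_derive.
- by apply: IHk hy => z /set_mem Uz; exact: open_eq_derive.
Qed.

Lemma Ck_on_cst k a : Ck_on k U (fun=> a).
Proof.
elim: k a => [|k IHk] a; first by split=> // z _; exact: cst_continuous.
apply/Ck_onSE; split=> [z _|z _||]; first exact: cst_continuous.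
- by split; exact: derivable_cst.
- by apply: Ck_on_eq (IHk 0) => z _; rewrite derive_cst.
- by apply: Ck_on_eq (IHk 0) => z _; rewrite derive_cst.
Qed.

Lemma Ck_onD k h l : Ck_on k U h -> Ck_on k U l -> Ck_on k U (h \+ l).
Proof.
have cD h' l' z : {for z, continuous h'} -> {for z, continuous l'} ->
    {for z, continuous (h' \+ l')} := @continuousD _ _ _ h' l' z.
elim: k h l => [|k IHk] h l.
  by move=> /Ck_on0E ch /Ck_on0E cl; apply/Ck_on0E => z Uz; exact: cD (ch z Uz) (cl z Uz).
move=> /Ck_onSE[ch dh hx hy] /Ck_onSE[cl dl lx ly]; apply/Ck_onSE; split.
- by move=> z Uz; exact: cD (ch z Uz) (cl z Uz).
- move=> z Uz; have [dhx dhy] := dh z Uz; have [dlx dly] := dl z Uz.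
  by split; [exact: derivableD dhx dlx|exact: derivableD dhy dly].
- apply: Ck_on_eq (IHk _ _ hx lx) => z /set_mem Uz.
  have [dhx _] := dh z Uz; have [dlx _] := dl z Uz.
  exact: esym (deriveD dhx dlx).
- apply: Ck_on_eq (IHk _ _ hy ly) => z /set_mem Uz.
  have [_ dhy] := dh z Uz; have [_ dly] := dl z Uz.
  exact: esym (deriveD dhy dly).
Qed.

Lemma Ck_onM k h l : Ck_on k U h -> Ck_on k U l -> Ck_on k U (h \* l).
Proof.
have cM h' l' z : {for z, continuous h'} -> {for z, continuous l'} ->
    {for z, continuous (h' \* l')} := @continuousM _ _ h' l' z.
elim: k h l => [|k IHk] h l.
  by move=> /Ck_on0E ch /Ck_on0E cl; apply/Ck_on0E => z Uz; exact: cM (ch z Uz) (cl z Uz).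
move=> sh sl; have sh' := Ck_on_le1 sh; have sl' := Ck_on_le1 sl.
move/Ck_onSE: sh => [ch dh hx hy]; move/Ck_onSE: sl => [cl dl lx ly].
apply/Ck_onSE; split.
- by move=> z Uz; exact: cM (ch z Uz) (cl z Uz).
- move=> z Uz; have [dhx dhy] := dh z Uz; have [dlx dly] := dl z Uz.
  by split; [exact: derivableM dhx dlx|exact: derivableM dhy dly].
- apply: Ck_on_eq (Ck_onD (IHk _ _ sh' lx) (IHk _ _ sl' hx)) => z /set_mem Uz.
  have [dhx _] := dh z Uz; have [dlx _] := dl z Uz.
  exact: esym (deriveM dhx dlx).
- apply: Ck_on_eq (Ck_onD (IHk _ _ sh' ly) (IHk _ _ sl' hy)) => z /set_mem Uz.
  have [_ dhy] := dh z Uz; have [_ dly] := dl z Uz.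
  exact: esym (deriveM dhy dly).
Qed.

Lemma Ck_onV k h : (forall z, U z -> h z != 0) -> Ck_on k U h ->
  Ck_on k U (fun z => (h z)^-1).
Proof.
move=> h0; have cV z : U z -> {for z, continuous h} ->
    {for z, continuous (fun z => (h z)^-1)}.
  by move=> Uz ch; exact: continuousV (h0 z Uz) ch.
elim: k => [|k IHk].
  by move=> /Ck_on0E ch; apply/Ck_on0E => z Uz; exact: cV (ch z Uz).
move=> sh; have sV := IHk (Ck_on_le1 sh).
move/Ck_onSE: sh => [ch dh hx hy].
have sVV := Ck_onM (Ck_on_cst k (-1)) (Ck_onM sV sV).
have dV z v : U z -> derivable h z v ->
    -1 * ((h z)^-1 * (h z)^-1) * 'D_v h z = 'D_v (fun z => (h z)^-1) z.
  by move=> Uz dhz; rewrite (deriveV (h0 z Uz) dhz) mulN1r -expr2 exprVn.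
apply/Ck_onSE; split.
- by move=> z Uz; exact: cV (ch z Uz).
- move=> z Uz; have [dhx dhy] := dh z Uz.
  by split; [exact: derivableV (h0 z Uz) dhx|exact: derivableV (h0 z Uz) dhy].
- by apply: Ck_on_eq (Ck_onM sVV hx) => z /set_mem Uz; case: (dh z Uz) => /(dV _ _ Uz).
- by apply: Ck_on_eq (Ck_onM sVV hy) => z /set_mem Uz; case: (dh z Uz) => _ /(dV _ _ Uz).
Qed.

End OpenSet.

Lemma is_derive_line h x v (t : R) : derivable h (t *: v + x) v ->
  is_derive t 1 (fun s : R => h (s *: v + x)) ('D_v h (t *: v + x)).
Proof.
have E : (fun s : R => s^-1 *: (((fun s : R => h (s *: v + x)) \o shift t) (s *: 1) -
    h (t *: v + x))) =
  (fun s : R => s^-1 *: ((h \o shift (t *: v + x)) (s *: v) - h (t *: v + x))).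
  by apply/funext => s /=; rewrite [s%:A]mulr1 scalerDl addrA.
by move=> dh; apply: DeriveDef; rewrite /derivable /derive E.
Qed.

Lemma derive0_line h x v (a b : R) : a <= b ->
  (forall t, a <= t <= b ->
     derivable h (t *: v + x) v /\ 'D_v h (t *: v + x) = 0) ->
  h (a *: v + x) = h (b *: v + x).
Proof.
move=> ab dh; pose k (s : R) := h (s *: v + x).
have dk t : a <= t <= b -> is_derive t 1 k 0.
  by move=> /dh[dt <-]; exact: is_derive_line.
have [||c _] := @MVT_segment _ k (fun=> 0) a b ab.
- by move=> t; rewrite in_itv /= => /andP[ta tb]; apply: dk; rewrite !ltW.
- apply: derivable_within_continuous => t.
  by rewrite in_itv /= => /dk[].
by rewrite mul0r /k => /eqP; rewrite subr_eq0 => /eqP.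
Qed.

Lemma derive0_line_itv h x v (a b : R) :
  (forall t, Num.min a b <= t <= Num.max a b ->
     derivable h (t *: v + x) v /\ 'D_v h (t *: v + x) = 0) ->
  h (a *: v + x) = h (b *: v + x).
Proof.
case: (leP a b) => [ab|/ltW ba] dh; first exact: derive0_line.
by apply/esym; exact: derive0_line.
Qed.

(** Only the partial derivatives are controlled, so z is joined to w by a horizontal and a vertical
    segment. Balls of the product are squares, hence contain both. *)
Lemma derive0_locally_constant U h z : open U -> U z ->
  (forall w, U w -> [/\ derivable h w (ex R), derivable h w (ey R),
     'D_(ex R) h w = 0 & 'D_(ey R) h w = 0]) ->
  \forall w \near z, h w = h z.
Proof.
move=> oU Uz dh; have /nbhs_ballP[e e0 zeU] : nbhs z U by exact: open_nbhs_nbhs.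
apply/nbhs_ballP; exists e => // w [zw1 zw2].
have mid (a b t : R) : ball a e b -> Num.min a b <= t <= Num.max a b -> ball a e t.
  rewrite /ball /= !ltr_norml; case: (leP a b) => _ /andP[? ?] /andP[? ?];
    apply/andP; split; lra.
case: z w zw1 zw2 zeU {Uz} => [z1 z2] [w1 w2] /= zw1 zw2 zeU.
have lineE1 t : t *: ex R + (0, z2) = (t, z2).
  by congr pair; rewrite /= ?scaler0 ?add0r // [t%:A]mulr1 addr0.
have lineE2 t : t *: ey R + (w1, 0) = (w1, t).
  by congr pair; rewrite /= ?scaler0 ?add0r // [t%:A]mulr1 addr0.
rewrite -(lineE2 w2) -(lineE1 z1).
rewrite -(@derive0_line_itv _ _ _ z2 w2) ?lineE2 ?lineE1 => [|t tz].
  rewrite -(lineE1 z1) -(lineE1 w1); apply/esym; apply: derive0_line_itv => t tz.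
  rewrite lineE1; have Ut : U (t, z2).
    by apply: zeU; split; [exact: mid tz|exact: ballxx].
  by case: (dh _ Ut) => hx _ hx0 _; exact: conj hx hx0.
rewrite lineE2; have Ut : U (w1, t).
  by apply: zeU; split; [exact: zw1|exact: mid tz].
by case: (dh _ Ut) => _ hy _ hy0; exact: conj hy hy0.
Qed.
End PlaneCalculus.

(** * Real functions on the surface: product rule and constancy *)

Section Surface.
Context {R : realType} {M : topologicalType}.
Variable S : riemann_surface R M.
Implicit Types (h l : M -> R) (c : chart R M) (z X : R * R).

Lemma smooth_cst (a : R) : smooth S (fun=> a).
Proof. by move=> c _ k; apply: Ck_on_cst; exact: chart_im_open. Qed.

Lemma smoothD h l : smooth S h -> smooth S l -> smooth S (fun p => h p + l p).
Proof.
by move=> sh sl c cS k; apply: Ck_onD; [exact: chart_im_open|exact: sh|exact: sl].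
Qed.

Lemma smoothM h l : smooth S h -> smooth S l -> smooth S (fun p => h p * l p).
Proof.
by move=> sh sl c cS k; apply: Ck_onM; [exact: chart_im_open|exact: sh|exact: sl].
Qed.

Lemma smoothV h : (forall p, h p != 0) -> smooth S h -> smooth S (fun p => (h p)^-1).
Proof. by move=> h0 sh c cS k; apply: Ck_onV => //; [exact: chart_im_open|exact: sh]. Qed.

Lemma smooth_sum (I : Type) (r : seq I) (h : I -> M -> R) :
  (forall i, smooth S (h i)) -> smooth S (fun p => \sum_(i <- r) h i p).
Proof.
move=> sh; elim: r => [|i r IHr].
  rewrite (_ : (fun p => _) = fun=> 0); first exact: smooth_cst.
  by apply/funext => p; rewrite big_nil.
rewrite (_ : (fun p => _) = fun p => h i p + \sum_(j <- r) h j p).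
  exact: smoothD.
by apply/funext => p; rewrite big_cons.
Qed.

Lemma smooth_derivable h c z : smooth S h -> atlas S c -> chart_im c z ->
  derivable (fun z => h (chart_inv c z)) z (ex R) /\
  derivable (fun z => h (chart_inv c z)) z (ey R).
Proof. by move=> sh cS cz; have /Ck_onSE[_ /(_ z cz)] := sh c cS 1%N. Qed.

Lemma dform_cst (a : R) c z X : dform (fun=> a) c z X = 0.
Proof. by rewrite /dform !derive_cst !mulr0 addr0. Qed.

Section Dform.
Variables (c : chart R M) (z : R * R).
Hypotheses (cS : atlas S c) (cz : chart_im c z).

Lemma dformD h l X : smooth S h -> smooth S l ->
  dform (fun p => h p + l p) c z X = dform h c z X + dform l c z X.
Proof.
move=> sh sl; have [hx hy] := smooth_derivable sh cS cz.
have [lx ly] := smooth_derivable sl cS cz.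
rewrite /dform (deriveD hx lx) (deriveD hy ly) !mulrDr; exact: addrACA.
Qed.

Lemma dformM h l X : smooth S h -> smooth S l ->
  dform (fun p => h p * l p) c z X =
  dform h c z X * l (chart_inv c z) + h (chart_inv c z) * dform l c z X.
Proof.
move=> sh sl; have [hx hy] := smooth_derivable sh cS cz.
have [lx ly] := smooth_derivable sl cS cz.
have leibniz (x y u v p q s t : R) : x * (u *: p + v *: q) + y * (u *: s + v *: t) =
    (x * q + y * t) * v + u * (x * p + y * s) by rewrite /GRing.scale /=; ring.
rewrite /dform (deriveM hx lx) (deriveM hy ly); exact: leibniz.
Qed.

Lemma dformZ (a : R) h X : smooth S h ->
  dform (fun p => a * h p) c z X = a * dform h c z X.
Proof. by move=> sh; rewrite (dformM _ (smooth_cst a) sh) dform_cst mul0r add0r. Qed.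

Lemma dform_sum (I : Type) (r : seq I) (h : I -> M -> R) X :
  (forall i, smooth S (h i)) ->
  dform (fun p => \sum_(i <- r) h i p) c z X = \sum_(i <- r) dform (h i) c z X.
Proof.
move=> sh; elim: r => [|i r IHr].
  rewrite big_nil (_ : (fun p => _) = fun=> 0) ?dform_cst //.
  by apply/funext => p; rewrite big_nil.
rewrite big_cons -IHr -dformD //; last exact: smooth_sum.
by congr (dform _ c z X); apply/funext => p; rewrite big_cons.
Qed.

End Dform.

(** The function is locally constant, so its level sets are open and closed in a connected
    surface. *)
Lemma dform0_constant h : smooth S h ->
  (forall c z X, atlas S c -> chart_im c z -> dform h c z X = 0) ->
  forall p q, h p = h q.
Proof.
move=> sh dh p q.
have lc x : \forall y \near x, h y = h x.
  have [c cS cx] := atlas_cover S x.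
  have loc : \forall w \near c x, h (chart_inv c w) = h (chart_inv c (c x)).
    apply: (@derive0_locally_constant _ _ (fun z => h (chart_inv c z)) _
      (chart_im_open (c := c)) (chart_mapP cx)) => w cw.
    have [hx hy] := smooth_derivable sh cS cw; split; [exact: hx|exact: hy|..].
      by have := dh c w (ex R) cS cw; rewrite /dform mul1r mul0r addr0.
    by have := dh c w (ey R) cS cw; rewrite /dform mul1r mul0r add0r.
  have := chart_map_cont cx loc; have : nbhs x (chart_dom c).
    by apply: open_nbhs_nbhs; split=> //; exact: chart_dom_open.
  by apply: filterS2 => y cy; rewrite /= !chart_mapK.
have hop (P : set R) : open (h @^-1` P).
  by rewrite openE => x Px; apply: filterS (lc x) => y /= ->.
suff /(congr1 (fun A => A q)) /= hE : h @^-1` [set h p] = setT.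
  by apply/esym; rewrite hE.
apply: (surface_connected S).
- by exists p.
- by exists (h @^-1` [set h p]); [exact: hop|rewrite setTI].
- exists (h @^-1` [set h p]); last by rewrite setTI.
  by rewrite -openC preimage_setC; exact: hop.
Qed.

End Surface.

(** * Clifford-valued and matrix-valued functions and their differentials *)

Section CliffordCalculus.
Context {R : realType} {M : topologicalType} {n : nat}.
Variable S : riemann_surface R M.
Local Notation Cl := (clifford R n).
Implicit Types (a b : M -> Cl) (g : M -> 'rV[R]_n) (F G : M -> 'M[Cl]_2).

Definition clsmooth a := forall K, smooth S (fun p => a p K).

Definition cldform a (c : chart R M) (z X : R * R) : Cl :=
  [ffun K => dform (fun p => a p K) c z X].

Lemma clsmooth_cst (x : Cl) : clsmooth (fun=> x).
Proof. by move=> K; exact: smooth_cst. Qed.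

Lemma clsmoothD a b : clsmooth a -> clsmooth b -> clsmooth (fun p => a p + b p).
Proof.
move=> sa sb K; rewrite (_ : (fun p => _) = fun p => a p K + b p K).
  exact: smoothD.
by apply/funext => p; rewrite ffunE.
Qed.

Lemma clsmoothM a b : clsmooth a -> clsmooth b -> clsmooth (fun p => a p * b p).
Proof.
move=> sa sb K; rewrite (_ : (fun p => _) = fun p =>
    \sum_T cl_sign R T (symdiff T K) * a p T * b p (symdiff T K)).
  by apply: smooth_sum => T; do 2 apply: smoothM => //; exact: smooth_cst.
by apply/funext => p; rewrite ffunE.
Qed.

Lemma clsmooth_tr a : clsmooth a -> clsmooth (fun p => (a p)^t).
Proof.
move=> sa K; rewrite (_ : (fun p => _) = fun p => (-1) ^+ 'C(#|K|, 2) * a p K).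
  by apply: smoothM => //; exact: smooth_cst.
by apply/funext => p; rewrite ffunE.
Qed.

Lemma clsmoothZ (k : R) a : clsmooth a -> clsmooth (fun p => k *: a p).
Proof.
move=> sa K; rewrite (_ : (fun p => _) = fun p => k * a p K).
  by apply: smoothM => //; exact: smooth_cst.
by apply/funext => p; rewrite ffunE.
Qed.

Lemma clsmoothN a : clsmooth a -> clsmooth (fun p => - a p).
Proof.
move=> /(clsmoothZ (-1)) sa; rewrite (_ : (fun p => _) = fun p => -1 *: a p) //.
by apply/funext => p; rewrite scaleN1r.
Qed.

Lemma clsmooth_vec g : vsmooth S g -> clsmooth (fun p => cl_vec (g p)).
Proof.
move=> sg K; rewrite (_ : (fun p => _) = fun p => \sum_i g p 0 i * (K == [set i]%SET)%:R).
  by apply: smooth_sum => i; apply: smoothM => //; exact: smooth_cst.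
by apply/funext => p; rewrite ffunE.
Qed.

Lemma cldform_cst (x : Cl) c z X : cldform (fun=> x) c z X = 0.
Proof. by apply/ffunP => K; rewrite !ffunE dform_cst. Qed.

Section Rules.
Variables (c : chart R M) (z : R * R).
Hypotheses (cS : atlas S c) (cz : chart_im c z).
Local Notation inv := (chart_inv c z).

Lemma cldformD a b X : clsmooth a -> clsmooth b ->
  cldform (fun p => a p + b p) c z X = cldform a c z X + cldform b c z X.
Proof.
move=> sa sb; apply/ffunP => K; rewrite !ffunE -(dformD cS cz _ (sa K) (sb K)).
by congr (dform _ c z X); apply/funext => p; rewrite ffunE.
Qed.

Lemma cldformM a b X : clsmooth a -> clsmooth b ->
  cldform (fun p => a p * b p) c z X =
  cldform a c z X * b inv + a inv * cldform b c z X.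
Proof.
move=> sa sb; apply/ffunP => K.
rewrite !ffunE -big_split /= (_ : (fun p => _) = fun p =>
    \sum_T cl_sign R T (symdiff T K) * (a p T * b p (symdiff T K))); last first.
  by apply/funext => p; rewrite ffunE; apply: eq_bigr => T _; rewrite mulrA.
have sab T : smooth S (fun p => a p T * b p (symdiff T K)) by apply: smoothM.
rewrite (dform_sum cS cz); last by move=> T; apply: smoothM => //; exact: smooth_cst.
apply: eq_bigr => T _; rewrite (dformZ cS cz) // (dformM cS cz) // !ffunE; ring.
Qed.

Lemma cldform_tr a X : clsmooth a ->
  cldform (fun p => (a p)^t) c z X = (cldform a c z X)^t.
Proof.
move=> sa; apply/ffunP => K; rewrite !ffunE -(dformZ cS cz) //.
by congr (dform _ c z X); apply/funext => p; rewrite ffunE.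
Qed.

Lemma cldformZ (k : R) a X : clsmooth a ->
  cldform (fun p => k *: a p) c z X = k *: cldform a c z X.
Proof.
move=> sa; apply/ffunP => K; rewrite !ffunE -[RHS](dformZ cS cz) //.
by congr (dform _ c z X); apply/funext => p; rewrite ffunE.
Qed.

Lemma cldformN a X : clsmooth a ->
  cldform (fun p => - a p) c z X = - cldform a c z X.
Proof.
move=> sa; rewrite -scaleN1r -cldformZ //; congr (cldform _ c z X).
by apply/funext => p; rewrite scaleN1r.
Qed.

Lemma cldform_vec g X : vsmooth S g ->
  cldform (fun p => cl_vec (g p)) c z X = cl_vec (vdform g c z X).
Proof.
move=> sg; apply/ffunP => K; rewrite !ffunE.
rewrite (_ : (fun p => _) = fun p => \sum_i (K == [set i]%SET)%:R * g p 0 i); last first.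
  by apply/funext => p; rewrite ffunE; apply: eq_bigr => i _; rewrite mulrC.
rewrite (dform_sum cS cz); last by move=> i; apply: smoothM => //; exact: smooth_cst.
by apply: eq_bigr => i _; rewrite (dformZ cS cz) // mxE mulrC.
Qed.

Lemma mxdformE F X i j : mxdform F c z X i j = cldform (fun p => F p i j) c z X.
Proof. by rewrite mxE. Qed.

Lemma mxdformM F G X : mxsmooth S F -> mxsmooth S G ->
  mxdform (fun p => F p *m G p) c z X =
  mxdform F c z X *m G inv + F inv *m mxdform G c z X.
Proof.
move=> sF sG; apply/matrixP => i j; rewrite [RHS]mxE !mulmx2E !mxdformE.
have sFG k : clsmooth (fun p => F p i k * G p k j).
  by apply: clsmoothM => K; [exact: sF|exact: sG].
rewrite (_ : (fun p => _) = fun p => F p i 0 * G p 0 j + F p i 1 * G p 1 j); last first.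
  by apply/funext => p; rewrite mulmx2E.
rewrite cldformD // !cldformM; try (move=> K; first [exact: sF|exact: sG]).
by rewrite addrACA.
Qed.

End Rules.

Lemma mxsmoothM F G : mxsmooth S F -> mxsmooth S G -> mxsmooth S (fun p => F p *m G p).
Proof.
move=> sF sG i j; change (clsmooth (fun p => (F p *m G p) i j)).
rewrite (_ : (fun p => _) = fun p => F p i 0 * G p 0 j + F p i 1 * G p 1 j).
  by apply: clsmoothD; apply: clsmoothM => K; by [exact: sF|exact: sG].
by apply/funext => p; rewrite mulmx2E.
Qed.

Lemma mxsmooth_mx2 (a b c d : M -> Cl) : clsmooth a -> clsmooth b -> clsmooth c ->
  clsmooth d -> mxsmooth S (fun p => mx2 (a p) (b p) (c p) (d p)).
Proof.
move=> sa sb sc sd i; move: i; apply: ord2P => j; move: j; apply: ord2P => K.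
- by rewrite (_ : (fun p => _) = fun p => a p K) //; apply/funext => p; rewrite mx2E.
- by rewrite (_ : (fun p => _) = fun p => b p K) //; apply/funext => p; rewrite mx2E.
- by rewrite (_ : (fun p => _) = fun p => c p K) //; apply/funext => p; rewrite mx2E.
- by rewrite (_ : (fun p => _) = fun p => d p K) //; apply/funext => p; rewrite mx2E.
Qed.

Lemma mxdform_mx2 (a b c d : M -> Cl) ch z X :
  mxdform (fun p => mx2 (a p) (b p) (c p) (d p)) ch z X =
  mx2 (cldform a ch z X) (cldform b ch z X) (cldform c ch z X) (cldform d ch z X).
Proof.
by apply: mx2P; rewrite mxdformE mx2E; congr (cldform _ ch z X); apply/funext => p;
  rewrite mx2E.
Qed.

Lemma cldform0_constant a : clsmooth a ->
  (forall c z X, atlas S c -> chart_im c z -> cldform a c z X = 0) ->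
  forall p q, a p = a q.
Proof.
move=> sa da p q; apply/ffunP => K; apply: (dform0_constant (sa K)) => c z X cS cz.
by have /ffunP/(_ K) := da c z X cS cz; rewrite !ffunE.
Qed.

Lemma mxsmooth_vadj F : mxsmooth S F -> mxsmooth S (fun p => vadj (F p)).
Proof.
by move=> sF; apply: mxsmooth_mx2; [|apply: clsmoothN..|]; apply: clsmooth_tr; exact: sF.
Qed.

Lemma mxdform_vadj F c z X : atlas S c -> chart_im c z -> mxsmooth S F ->
  mxdform (fun p => vadj (F p)) c z X = vadj (mxdform F c z X).
Proof.
move=> cS cz sF; rewrite mxdform_mx2 /vadj !mxdformE.
by congr mx2; rewrite ?(cldformN cS cz) ?(cldform_tr cS cz) //; try apply: clsmooth_tr;
  exact: sF.
Qed.

(* F G^-1 is constant when F and G have the same Maurer-Cartan form A. *)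
Lemma frame_unique F G (A : mx_form R M n) (p0 : M) : (0 < n)%N ->
  (forall c z X, atlas S c -> chart_im c z -> vadj (A c z X) = - A c z X) ->
  is_frame_of S F A -> is_frame_of S G A ->
  exists2 B, SLGamma B & forall p, F p = B *m G p.
Proof.
move=> n0 adjA [sF slF dF] [sG slG dG].
exists (F p0 *m vadj (G p0)); first by apply: SLGammaM => //; exact: SLGammaV.
have sH : mxsmooth S (fun p => F p *m vadj (G p)).
  by apply: mxsmoothM => //; exact: mxsmooth_vadj.
have dH c z X : atlas S c -> chart_im c z ->
    mxdform (fun p => F p *m vadj (G p)) c z X = 0.
  move=> cS cz; rewrite (mxdformM cS cz) //; last exact: mxsmooth_vadj.
  rewrite mxdform_vadj // dF // dG // vadjM adjA //.
  by rewrite mulNmx mulmxN mulmxA subrr.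
move=> p; have -> : F p0 *m vadj (G p0) = F p *m vadj (G p).
  apply/matrixP => i j; apply: (cldform0_constant (sH i j)) => c z X cS cz.
  by rewrite -mxdformE dH // mxE.
by rewrite -mulmxA SLGamma_vadj_mul // mulmx1.
Qed.

End CliffordCalculus.

(** * Gauging frames of a pair *)

Section Dilation.
Context {R : realType} {n : nat}.
Local Notation Cl := (clifford R n).

Lemma dot_delta (i : 'I_n) : dot (delta_mx 0 i) (delta_mx 0 i) = 1 :> R.
Proof.
rewrite /dot (bigD1 i) //= big1 => [|j ji]; rewrite !mxE !eqxx ?mulr1 ?addr0 //.
by rewrite (negPf ji) mulr0.
Qed.

Lemma clifford_group_basis (K : {set 'I_n}) : clifford_group (cl_basis R K).
Proof.
rewrite cl_basis_prod; elim/big_ind: _ => [|a b|i _].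
- exact: clifford_group1.
- exact: clifford_groupM.
by constructor; rewrite -dot_eq0 dot_delta oner_eq0.
Qed.

Lemma cl_basis_mul_tr (K : {set 'I_n}) :
  cl_basis R K * (cl_basis R K)^t = ((-1) ^+ #|K|)%:A.
Proof.
rewrite cl_basis_prod -sum1_card; elim: (index_enum _) => [|i s IHs].
  by rewrite !big_nil cl_tr1 mulr1 expr0 scale1r.
rewrite !big_cons; case: ifP => // _.
rewrite cl_trM mulrA -(mulrA (cl_vec _)) IHs mulr_algr -scalerAl cl_tr_vec.
by rewrite cl_vec_sqr dot_delta scale1r exprS mulN1r scalerN scaleNr.
Qed.

(** Each generator commutes with itself and anticommutes with the n - 1 others, and n - 1 has the
    parity of n + 1. *)
Lemma cl_volume_vec (v : 'rV[R]_n) :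
  cl_basis R [set: 'I_n]%SET * cl_vec v = (-1) ^+ n.+1 *: (cl_vec v * cl_basis R [set: 'I_n]%SET).
Proof.
rewrite cl_vecE mulr_sumr mulr_suml scaler_sumr; apply: eq_bigr => i _.
rewrite -scalerAr -scalerAl scalerA mulrC -scalerA; congr (_ *: _).
rewrite !cl_basisM symdiffC scalerA; congr (_ *: _).
have := cl_sign_swap R [set: 'I_n]%SET [set i]%SET.
rewrite finset.setTI cardsT card_ord cards1 muln1 addn1.
move=> <-; rewrite -mulrA -[LHS]mulr1; congr (_ * _).
by rewrite -expr2 sqrr_sign.
Qed.

(* The dilation v |-> lam v is v |-> D v D^t; for lam < 0 the product of all
   the generators supplies v |-> - v. *)
Lemma clifford_dilation (lam : R) : (0 < n)%N -> lam != 0 -> exists (D : Cl) (N : R),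
  [/\ clifford_group D, N ^+ 2 = lam ^+ 2, D * D^t = N%:A, D^t * D = N%:A
    & forall v, is_vec v -> N *: (D * v) = lam *: (v * D)].
Proof.
(* The element w carries the sign alone: w v w^t = sg(lam) v with w w^t = m = 1 or -1. Then D is w
   scaled by the square root of |lam|, so N = |lam| m may differ from lam by a sign. *)
move=> n0 lam0; have [w [m [gw wE wv lamE]]] : exists (w : Cl) (m : R),
    [/\ clifford_group w, w * w^t = m%:A,
       forall v, is_vec v -> m *: (w * v) = Num.sg lam *: (v * w) & m ^+ 2 = 1].
  case: (ltgtP lam 0) lam0 => // lam0 _.
    exists (cl_basis R [set: 'I_n]%SET), ((-1) ^+ n); split.
    - exact: clifford_group_basis.
    - by rewrite cl_basis_mul_tr cardsT card_ord.
    - move=> _ [v ->]; rewrite cl_volume_vec scalerA ltr0_sg //; congr (_ *: _).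
      by rewrite exprS mulrCA -expr2 sqrr_sign mulr1.
    - exact: sqrr_sign.
  exists 1, 1; split; rewrite ?expr1n ?cl_tr1 ?mulr1 ?scale1r //.
    exact: clifford_group1.
  by move=> v _; rewrite gtr0_sg // mulr1 mul1r !scale1r.
have slam0 : Num.sqrt `|lam| != 0 by rewrite gt_eqF // sqrtr_gt0 normr_gt0.
have gD := clifford_groupZ n0 slam0 gw.
have [N N0 [DE tDE _]] := clifford_group_similitude gD.
have NE : N = `|lam| * m.
  apply/eqP; rewrite -subr_eq0; have : (N - `|lam| * m)%:A == 0 :> Cl.
    rewrite scalerBl -DE linearZ /= -scalerAl -scalerAr wE !scalerA.
    by rewrite -expr2 sqr_sqrtr ?normr_ge0 // subrr.
  by rewrite scaler_eq0 oner_eq0 orbF.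
exists (Num.sqrt `|lam| *: w), N; split=> // [|v vv].
  by rewrite NE exprMn lamE mulr1 real_normK ?num_real.
rewrite NE -!(scalerAl, scalerAr) [LHS]scalerA mulrAC -scalerA (wv v vv) !scalerA.
congr (_ *: _); have := numEsg lam; move: (Num.sg lam) `|lam| => e m' ->.
by rewrite mulrAC (mulrC m').
Qed.

End Dilation.

(** * Algebra of the gauge at one point *)

Section Gauge.
Context {R : realType} {n : nat}.
Local Notation Cl := (clifford R n).
Variables (c d u : Cl).
Hypotheses (vu : is_vec u) (gu : clifford_group u) (gd : clifford_group d).
Hypothesis ucd : u * c * d^t = 1.

Let mul1C (x y : Cl) : x \is a GRing.unit -> x * y = 1 -> y * x = 1.
Proof. by move=> ux xy; rewrite -[y](mulKr ux) xy mulr1 mulVr. Qed.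

(** This and the next four identities are rotations and transposes of u c d^t = 1: factors are
    units, and the vector u is its own transpose. *)
Lemma gauge_dtuc : d^t * u * c = 1.
Proof.
have ud := clifford_group_unit (clifford_group_tr gd); rewrite -mulrA.
by rewrite -[u * c](mulrK ud) ucd mul1r mulrV.
Qed.

Lemma gauge_cdtu : c * d^t * u = 1.
Proof. by apply: mul1C; [exact: clifford_group_unit|rewrite mulrA]. Qed.

Lemma gauge_dctu : d * c^t * u = 1.
Proof.
by have /(congr1 (@cl_tr R n)) := ucd; rewrite !cl_trM cl_trK cl_tr1 (is_vec_tr vu) mulrA.
Qed.

Lemma gauge_ctud : c^t * u * d = 1.
Proof.
have /(congr1 (@cl_tr R n)) := gauge_dtuc.
by rewrite !cl_trM cl_trK cl_tr1 (is_vec_tr vu) mulrA.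
Qed.

Lemma gauge_udct : u * d * c^t = 1.
Proof.
have /(congr1 (@cl_tr R n)) := gauge_cdtu.
by rewrite !cl_trM cl_trK cl_tr1 (is_vec_tr vu) mulrA.
Qed.

(** Both sides are the inverse of u. *)
Lemma gauge_dctE : d * c^t = c * d^t.
Proof.
by rewrite -[LHS]mul1r -gauge_cdtu -!mulrA (mulrA u) gauge_udct mulr1.
Qed.

(* The entries of F^-1 dF for F = (a b; c d) with b = f d and a = (f + u) c;
   the three hypotheses are the differentials of these two relations and of
   u c d^t = 1. *)
Lemma pair_frame_form (f df dg al be ga de : Cl) : is_vec df ->
  (f + u) * c * be + f * d * de = df * d + f * (c * be + d * de) ->
  (f + u) * c * al + f * d * ga = (df + dg) * c + (f + u) * (c * al + d * ga) ->
  (dg * c + u * (c * al + d * ga)) * d^t + u * c * (c * be + d * de)^t = 0 ->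
  [/\ be = d^t * df * d, ga = - (c^t * (df + dg) * c) & de = - al^t].
Proof.
move=> vdf Hb Ha Hdet.
have {Hb} ucbe : u * c * be = df * d.
  apply: (addIr (f * (c * be + d * de))); rewrite -Hb mulrDr !mulrDl !mulrA addrA.
  by rewrite (addrC (u * c * be)).
have {Ha} udga : u * d * ga = - ((df + dg) * c).
  apply/eqP; rewrite -addr_eq0 addrC; apply/eqP.
  apply: (addIr ((f + u) * c * al + f * d * ga)); rewrite add0r [in RHS]Ha -addrA.
  congr (_ + _); rewrite mulrDr (mulrDl _ _ (d * ga)) !mulrA addrC -!addrA.
  by congr (_ + _).
have beE : be = d^t * df * d.
  by rewrite -[LHS]mul1r -gauge_dtuc -mulrA -(mulrA _ u) mulrA -mulrA (mulrA u) ucbe mulrA.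
split=> //.
  by rewrite -[LHS]mul1r -gauge_ctud -!mulrA (mulrA u) udga mulrN mulrA.
have tbe : be^t = be.
  by rewrite beE !cl_trM cl_trK (is_vec_tr vdf) mulrA.
(* In the differential of u c d^t = 1 the terms in df cancel because c d^t = d c^t. *)
have {Hdet} : u * c * (al + de^t) * d^t = 0.
  rewrite -[RHS]Hdet cl_trD !cl_trM tbe.
  have -> : dg * c + u * (c * al + d * ga) = u * c * al - df * c.
    rewrite mulrDr !mulrA udga mulrDl opprD addrC -!addrA; congr (_ + _).
    by rewrite addNr addr0.
  have -> : u * c * (be * c^t + de^t * d^t) = df * c * d^t + u * c * de^t * d^t.
    by rewrite mulrDr !mulrA ucbe -(mulrA df) gauge_dctE !mulrA.
  by rewrite mulrBl addrA subrK -mulrDl -mulrDr.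
move=> /(congr1 (fun x => d^t * x * u * c)); rewrite mulr0 !mul0r => E.
have {E} : al + de^t = 0.
  rewrite -[RHS]E -[LHS]mulr1 -gauge_dtuc -[LHS]mul1r -{1}gauge_dtuc.
  by rewrite !mulrA.
by move=> /(congr1 (@cl_tr R n)) /eqP; rewrite cl_trD cl_trK linear0 addrC addr_eq0 => /eqP.
Qed.

Lemma mx2M (a' b' c' d' a2 b2 c2 d2 : Cl) :
  mx2 a' b' c' d' *m mx2 a2 b2 c2 d2 =
  mx2 (a' * a2 + b' * c2) (a' * b2 + b' * d2) (c' * a2 + d' * c2) (c' * b2 + d' * d2).
Proof. by apply: mx2P; rewrite mulmx2E !mx2E. Qed.

Lemma mx2D (a' b' c' d' a2 b2 c2 d2 : Cl) :
  mx2 a' b' c' d' + mx2 a2 b2 c2 d2 = mx2 (a' + a2) (b' + b2) (c' + c2) (d' + d2).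
Proof. by apply: mx2P; rewrite [LHS]mxE !mx2E. Qed.

Lemma offdiag_mx2 (x y : Cl) : offdiag_mx x y = mx2 0 x y 0.
Proof. by apply: mx2P; rewrite mx2E mxE. Qed.

Section GaugeMatrix.
Variables (df dfc dg be ga de D : Cl) (r lam N : R).
Hypotheses (lam0 : lam != 0) (NE : N ^+ 2 = lam ^+ 2).
Hypotheses (vdf : is_vec df) (vdfc : is_vec dfc).
Hypothesis dgE : dg = r *: (u * dfc * u) - df.
Hypothesis beE : be = d^t * df * d.
Hypothesis gaE : ga = - (c^t * (df + dg) * c).
Hypothesis DvE : forall v, is_vec v -> N *: (D * v) = lam *: (v * D).

Definition gauge : 'M[Cl]_2 :=
  mx2 (d^t * D) 0 (- lam^-1 *: (c^t * D)) (N^-1 *: (c^t * u * D)).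

(* The gauge carries the form of parameter lam of the pair to the form of the
   T-transform of f. *)
Lemma gauge_form :
  mx2 (- de^t) (lam *: be) (lam *: ga) de *m gauge +
  mx2 ((c * be + d * de)^t * D) 0
      (- lam^-1 *: ((c * - de^t + d * ga)^t * D))
      (N^-1 *: (((c * - de^t + d * ga)^t * u + c^t * dg) * D)) =
  gauge *m offdiag_mx df (((1 - lam ^+ 2) * r) *: dfc).
Proof.
have N0 : N != 0 by rewrite -sqrf_eq0 NE sqrf_eq0.
have tbe : be^t = be by rewrite beE !cl_trM cl_trK (is_vec_tr vdf) mulrA.
have sE : df + dg = r *: (u * dfc * u) by rewrite dgE addrC subrK.
have tga : ga^t = ga.
  rewrite gaE sE cl_trN !(cl_trM, linearZ) /= cl_trM cl_trK !cl_trM.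
  by rewrite (is_vec_tr vdfc) (is_vec_tr vu) !mulrA.
have gadt : ga * d^t = - (r *: (c^t * u * dfc)).
  rewrite gaE sE mulNr -!(scalerAr, scalerAl); congr (- (_ *: _)).
  by rewrite -[RHS]mulr1 -ucd !mulrA.
(* D passes a vector at the cost of lam / N, whose square is 1. *)
have Dv v : is_vec v -> D * v = (N^-1 * lam) *: (v * D).
  by move=> vv; rewrite -scalerA -DvE // scalerA mulVf // scale1r.
have dcE : (c * - de^t + d * ga)^t = - (de * c^t) + ga * d^t.
  by rewrite cl_trD !cl_trM tga cl_trN cl_trK mulNr.
rewrite /gauge offdiag_mx2 !mx2M mx2D; congr mx2; rewrite ?(mulr0, mul0r, add0r, addr0).
- rewrite -scalerAl -scalerAr scalerA mulrN mulfV // scaleN1r cl_trD !cl_trM tbe.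
  by rewrite mulrDl mulNr !mulrA -opprD [X in _ + X]addrC addNr.
- have becE : be * (c^t * u * D) = d^t * (df * D).
    by rewrite beE -[in RHS](mul1r D) -gauge_dctu !mulrA.
  rewrite -scalerAl -scalerAr becE -(mulrA _ D) (Dv _ vdf) -scalerAr scalerA.
  by rewrite mulrC.
(* The diagonal part [de] cancels between the form and the differential of the gauge. What survives
   has coefficient lam from the scaled form and - lam^-1 from the differential; moving D past df^c
   then yields 1 - lam^2. *)
- have combine (Y Z : Cl) :
      lam *: Z - lam^-1 *: Y - lam^-1 *: (- Y + Z) = (lam - lam^-1) *: Z.
    by rewrite scalerDr scalerN opprD opprK addrA subrK -scalerBl.
  transitivity ((lam - lam^-1) *: (ga * d^t * D)).
    by rewrite -(combine (de * c^t * D)) dcE mulrDl mulNr !scaleNr mulrN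
       -scalerAl -scalerAr !mulrA.
  rewrite gadt mulNr -!(scalerAl, scalerAr) -(mulrA _ D) (Dv _ vdfc) -scalerAr.
  rewrite scalerN -scaleNr !mulrA !scalerA; congr (_ *: _).
  transitivity (N ^- 2 * ((1 - lam ^+ 2) * r * lam)); first by rewrite NE; field.
  by rewrite -exprVn; ring.
- have gaduE : ga * d^t * u = - (c^t * (df + dg)).
    by rewrite gaE !mulNr -[in RHS](mulr1 (df + dg)) -gauge_cdtu !mulrA.
  have -> : (c * - de^t + d * ga)^t * u + c^t * dg = - (de * c^t * u) - c^t * df.
    by rewrite dcE mulrDl mulNr gaduE mulrDr opprD addrA subrK.
  rewrite -scalerAr -scalerDr mulrDl !mulNr !mulrA addrA subrr add0r.
  rewrite -scalerAl -(mulrA _ D) (Dv _ vdf) -scalerAr !scalerA !mulrA.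
  by rewrite scalerN -scaleNr; congr (_ *: _); field; rewrite lam0 N0.
Qed.

Lemma gauge_SLGamma : (0 < n)%N -> clifford_group D -> D * D^t = N%:A ->
  D^t * D = N%:A -> clifford0 c -> is_vec (c^t * d) -> SLGamma gauge.
Proof.
move=> n0 gD DDt DtD gc vcd; have N0 : N != 0 by rewrite -sqrf_eq0 NE sqrf_eq0.
apply/SLGammaE; rewrite !mx2E; have gd0 : clifford0 d by right.
have gD0 : clifford0 D by right.
have gu0 : clifford0 u by right.
split; rewrite ?linear0 ?mulr0 ?mul0r ?subr0.
- split; [|by left|apply: clifford0Z => //|apply: clifford0Z => //].
  + by apply: clifford0M => //; exact: clifford0_tr.
  + by apply: clifford0M => //; exact: clifford0_tr.
  + by do 2 apply: clifford0M => //; exact: clifford0_tr.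
- split; last exact: is_vec0.
  rewrite linearZ /= cl_trM cl_trK -scalerAr -mulrA (mulrA D) DDt mulr_algl.
  rewrite -scalerAr; do 2 apply: is_vecZ.
  by apply: is_vec_trE; rewrite cl_trM cl_trK.
- split; first exact: is_vec0.
  have [L cL] : exists L : R, c * c^t = L%:A.
    by case: gc => [->|/clifford_group_similitude[L _ [-> _ _]]];
      [exists 0; rewrite mul0r scale0r|exists L].
  have [_ _ [_ _ /(_ u vu)[_ vDuD]]] := clifford_group_similitude gD.
  rewrite linearZ /= cl_trM cl_trK -scalerAl -scalerAr.
  rewrite !mulrA -(mulrA _ c) cL mulr_algr -!scalerAl.
  by do 3 apply: is_vecZ.
- rewrite linearZ /= !cl_trM cl_trK (is_vec_tr vu) -scalerAr -mulrA (mulrA D) DDt.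
  by rewrite mulr_algl -scalerAr scalerA mulVf // scale1r mulrA gauge_dtuc.
Qed.

Lemma gauge_mobius : SLGamma gauge -> mobius gauge (Some 0) = Some 0.
Proof.
move=> /SLGammaE[_ _ _]; rewrite !mx2E mul0r subr0 => det.
rewrite /mobius !mx2E linear0 !mulr0 !add0r ifN; last first.
  by apply: contra_eq_neq det => ->; rewrite linear0 mulr0 eq_sym oner_neq0.
by rewrite mul0r -[0 in LHS](linear0 (@cl_vec R n)) cl_vecK.
Qed.

End GaugeMatrix.
End Gauge.

(** * From a frame of the pair to a frame of the T-transform *)

Section Transforms.
Context {R : realType} {M : topologicalType} {n : nat}.
Variable S : riemann_surface R M.
Local Notation Cl := (clifford R n).

Lemma mobius_pair (B : 'M[Cl]_2) (v w : 'rV[R]_n) : SLGamma B ->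
  mobius B (Some 0) = Some v -> mobius B None = Some w ->
  [/\ clifford_group (B 1 0), clifford_group (B 1 1), B 0 0 = cl_vec w * B 1 0
    & B 0 1 = cl_vec v * B 1 1].
Proof.
move=> /SLGammaE[[ga gb gc gd] [vac vbd] _ _].
rewrite /mobius linear0 !mulr0 !add0r.
case: eqP => // /eqP d0 [vE]; case: eqP => // /eqP c0 [wE].
have {}gc := clifford0_neq0 gc c0; have {}gd := clifford0_neq0 gd d0.
split=> //; rewrite -?vE -?wE vec_partK ?divrK ?clifford_group_unit //.
  exact: is_vec_div.
exact: is_vec_div.
Qed.

(** In a d^t - b c^t the terms containing v cancel, since c d^t is a vector and so equals d c^t. *)
Lemma mobius_pair_det (B : 'M[Cl]_2) (v u : 'rV[R]_n) : SLGamma B ->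
  B 0 0 = cl_vec (v + u) * B 1 0 -> B 0 1 = cl_vec v * B 1 1 ->
  cl_vec u * B 1 0 * (B 1 1)^t = 1.
Proof.
move=> /SLGammaE[[_ _ gc _] _ [_ vcd] <-] -> ->.
rewrite linearD /= !mulrDl -!mulrA.
have -> : B 1 1 * (B 1 0)^t = B 1 0 * (B 1 1)^t.
  by rewrite -[RHS](is_vec_tr (is_vec_swap_tr gc vcd)) cl_trM cl_trK.
by rewrite addrC addrA addNr add0r.
Qed.

Lemma curved_flat_form (lam : R) (B : 'M[Cl]_2) :
  diag_part B + lam%:A *: offdiag_part B =
  mx2 (B 0 0) (lam *: B 0 1) (lam *: B 1 0) (B 1 1).
Proof.
by apply: mx2P; rewrite mx2E !mxE /= ?mulr0 ?add0r ?addr0 ?mulr_algl.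
Qed.

Definition T_form (s : R) (f fc : M -> 'rV[R]_n) : mx_form R M n := fun c z X =>
  offdiag_mx (cl_vec (vdform f c z X)) (s *: cl_vec (vdform fc c z X)).

(** The infinitesimal form of [A *m vadj A = 1%:M], as required for uniqueness of frames. *)
Lemma T_form_vadj s f fc c z X : vadj (T_form s f fc c z X) = - T_form s f fc c z X.
Proof.
have tvec (v : 'rV[R]_n) : (cl_vec v)^t = cl_vec v := cl_tr_vec v.
by apply: mx2P; rewrite [RHS]mxE mx2E !mxE /= ?linear0 ?oppr0 // ?linearZ /= tvec.
Qed.

Section ExistenceOfFrames.
Variables (f fc g : M -> 'rV[R]_n) (r lam : R) (F Flam : M -> 'M[Cl]_2).
Variable A : mx_form R M n.
Hypotheses (sf : vsmooth S f) (gsol : darboux_solution S r f fc g) (lam0 : lam != 0).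
Hypothesis frF : is_frame_of S F A.
Hypothesis pairF : forall p, mobius (F p) (Some 0) = Some (f p) /\
  mobius (F p) None = Some (darboux_transform f g p).
Hypothesis frFlam : is_frame_of S Flam
  (fun c z X => diag_part (A c z X) + lam%:A *: offdiag_part (A c z X)).

Local Notation cF p := (F p 1 0).
Local Notation dF p := (F p 1 1).
Local Notation uF p := (cl_vec (g p)).

Lemma pair_frameP p : [/\ clifford_group (cF p), clifford_group (dF p),
  F p 0 0 = cl_vec (f p + g p) * cF p & F p 0 1 = cl_vec (f p) * dF p].
Proof. by case: frF => _ sl _; have [m0 m1] := pairF p; exact: mobius_pair. Qed.

Lemma pair_frame_det p : uF p * cF p * (dF p)^t = 1.
Proof.
by case: frF => _ sl _; have [_ _ aE bE] := pair_frameP p; exact: mobius_pair_det aE bE.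
Qed.

Section AtPoint.
Variables (c : chart R M) (z X : R * R).
Hypotheses (cS : atlas S c) (cz : chart_im c z).
Local Notation p := (chart_inv c z).
Local Notation df := (cl_vec (vdform f c z X)).
Local Notation dfc := (cl_vec (vdform fc c z X)).
Local Notation dg := (cl_vec (vdform g c z X)).
Local Notation Az := (A c z X).

Lemma pair_frame_entries :
  [/\ Az 0 1 = (dF p)^t * df * dF p,
      Az 1 0 = - ((cF p)^t * (df + dg) * cF p)
    & Az 1 1 = - (Az 0 0)^t].
Proof.
have [sF slF eqF] := frF; have [sg g0 eqg] := gsol.
have gu : clifford_group (uF p) by constructor.
have [gc gd aE bE] := pair_frameP p.
have dFE i j : cldform (fun q => F q i j) c z X = F p i 0 * Az 0 j + F p i 1 * Az 1 j.
  by rewrite -mxdformE eqF // mulmx2E.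
have su := clsmooth_vec sg; have sfv := clsmooth_vec sf.
have scF : clsmooth S (fun q => cF q) := sF 1 0.
have sdF : clsmooth S (fun q => dF q) := sF 1 1.
apply: (pair_frame_form (is_vec_cl_vec (g p)) gu gd (pair_frame_det p)
  (f := cl_vec (f p))); first exact: is_vec_cl_vec.
- have := dFE 0 1; rewrite aE bE linearD /= => <-.
  rewrite (_ : (fun q => _) = fun q => cl_vec (f q) * dF q); last first.
    by apply/funext => q; case: (pair_frameP q).
  by rewrite (cldformM cS cz) // (cldform_vec cS cz) // dFE.
- have := dFE 0 0; rewrite aE bE [cl_vec (_ + _)]linearD /= => <-.
  rewrite (_ : (fun q => _) = fun q => (cl_vec (f q) + uF q) * cF q); last first.
    by apply/funext => q; case: (pair_frameP q) => _ _ -> _; rewrite linearD.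
  have sfu := clsmoothD sfv su.
  by rewrite (cldformM cS cz) // (cldformD cS cz) // !(cldform_vec cS cz) // dFE.
- have suc := clsmoothM su scF; have sdt := clsmooth_tr sdF.
  rewrite -!dFE -(cldform_vec cS cz _ sg) -(cldformM cS cz) // -(cldform_tr cS cz) //.
  rewrite -(cldformM cS cz) // (_ : (fun q => _) = fun=> 1) ?cldform_cst //.
  by apply/funext => q; exact: pair_frame_det.
Qed.

End AtPoint.
Lemma T_frame_exists : (0 < n)%N -> exists G,
  is_frame_of S G (T_form ((1 - lam ^+ 2) * r) f fc) /\
  forall p, mobius (G p) (Some 0) = mobius (Flam p) (Some 0).
Proof.
move=> n0; have [D [N [gD NE DDt DtD DvE]]] := clifford_dilation n0 lam0.
have [sF slF eqF] := frF; have [sg g0 eqg] := gsol.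
have [sFl slFl eqFl] := frFlam.
have scF : clsmooth S (fun q => cF q) := sF 1 0.
have sdF : clsmooth S (fun q => dF q) := sF 1 1.
have su := clsmooth_vec sg.
have gu p : clifford_group (uF p) by constructor.
have vu p : is_vec (uF p) by exact: is_vec_cl_vec.
have gd p : clifford_group (dF p) by case: (pair_frameP p).
(* The gauge is built from the entries of [F], not of [Flam], so its differential involves [A]
   without the factor lam. *)
pose P p := gauge (cF p) (dF p) (uF p) D lam N.
have sct := clsmooth_tr scF; have sdt := clsmooth_tr sdF.
have sctu := clsmoothM sct su.
have sD : clsmooth S (fun=> D) by exact: clsmooth_cst.
have s0 : clsmooth S (fun=> 0 : Cl) by exact: clsmooth_cst.
have sdtD := clsmoothM sdt sD; have sctD := clsmoothM sct sD.
have sctuD := clsmoothM sctu sD.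
have slP p : SLGamma (P p).
  have [gc _ _ _] := pair_frameP p; move/SLGammaE: (slF p) => [_ _ [_ vcd] _].
  apply: gauge_SLGamma => //; first exact: pair_frame_det.
  by right.
have sP : mxsmooth S P.
  by apply: mxsmooth_mx2 => //; exact: clsmoothZ.
exists (fun p => Flam p *m P p); split; last first.
  move=> p; rewrite mobius_mul0 //; congr (mobius _ _).
  exact: gauge_mobius (slP p).
split=> [|p|c z X cS cz]; first exact: mxsmoothM.
  exact: SLGammaM.
have [beE gaE deE] := pair_frame_entries X cS cz.
rewrite (mxdformM cS cz) // eqFl // -!mulmxA -mulmxDr; congr (_ *m _).
have AE : diag_part (A c z X) + lam%:A *: offdiag_part (A c z X) =
    mx2 (- (A c z X 1 1)^t) (lam *: A c z X 0 1) (lam *: A c z X 1 0) (A c z X 1 1).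
  by rewrite curved_flat_form deE cl_trN cl_trK opprK.
have dFE i j : cldform (fun q => F q i j) c z X = F (chart_inv c z) i 0 * A c z X 0 j +
    F (chart_inv c z) i 1 * A c z X 1 j.
  by rewrite -mxdformE eqF // mulmx2E.
have alE : A c z X 0 0 = - (A c z X 1 1)^t by rewrite deE linearN /= cl_trK opprK.
have trD q (sq : clsmooth S q) : cldform (fun p => (q p)^t * D) c z X =
    (cldform q c z X)^t * D.
  by rewrite (cldformM cS cz X (clsmooth_tr sq) sD) cldform_cst mulr0 addr0
    (cldform_tr cS cz X sq).
have uD : cldform (fun q => (cF q)^t * uF q * D) c z X =
    ((cldform (fun q => cF q) c z X)^t * uF (chart_inv c z) +
     (cF (chart_inv c z))^t * cl_vec (vdform g c z X)) * D.
  rewrite (cldformM cS cz X sctu sD) cldform_cst mulr0 addr0.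
  by rewrite (cldformM cS cz X sct su) (cldform_tr cS cz X scF) (cldform_vec cS cz X sg).
rewrite mxdform_mx2 cldform_cst (cldformZ cS cz _ X sctD) (cldformZ cS cz _ X sctuD).
rewrite (trD _ sdF) (trD _ scF) uD !dFE alE AE.
exact: (gauge_form (vu _) (gu _) (pair_frame_det _) (A c z X 1 1) lam0 NE
  (is_vec_cl_vec _) (is_vec_cl_vec _) (eqg c z X cS cz) beE gaE DvE).
Qed.

End ExistenceOfFrames.
End Transforms.

(** * Isothermic surfaces under Darboux transforms *)

Section VectorIdentities.
Context {R : realType} {n : nat}.
Local Notation Cl := (clifford R n).
Implicit Types (v w x y g : 'rV[R]_n).

Lemma dotDl v w x : dot (v + w) x = dot v x + dot w x.
Proof. by rewrite /dot -big_split; apply: eq_bigr => i _; rewrite mxE mulrDl. Qed.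

Lemma dot_ge0 v : 0 <= dot v v.
Proof. by apply: sumr_ge0 => i _; rewrite -expr2 sqr_ge0. Qed.

Lemma scalar_cl_inj : injective (fun k : R => k%:A : Cl).
Proof.
move=> k l /eqP; rewrite -subr_eq0 -scalerBl scaler_eq0 oner_eq0 orbF subr_eq0.
exact: eqP.
Qed.

Lemma cl_vec_unit g : g != 0 -> (cl_vec g : Cl) \is a GRing.unit.
Proof. by move=> g0; apply: clifford_group_unit; constructor. Qed.

Lemma cl_vec_inv g : g != 0 -> (cl_vec g : Cl)^-1 = cl_vec (- (dot g g)^-1 *: g).
Proof.
move=> g0; have gg : dot g g != 0 by rewrite dot_eq0.
have gE : - (dot g g)^-1 *: (cl_vec g * cl_vec g) = 1 :> Cl.
  by rewrite cl_vec_sqr scalerN scaleNr opprK scalerA mulVf // scale1r.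
rewrite linearZ /=.
have gl : cl_vec g * (- (dot g g)^-1 *: cl_vec g) = 1 :> Cl by rewrite -scalerAr.
have gr : (- (dot g g)^-1 *: cl_vec g) * cl_vec g = 1 :> Cl by rewrite -scalerAl.
by case: (mulr1_eq_invr gl gr).
Qed.

Lemma dot_cl v w : (- (2 * dot v w))%:A = cl_vec v * cl_vec w + cl_vec w * cl_vec v :> Cl.
Proof. by rewrite cl_vec_comm scaleNr. Qed.

Lemma dot_eq_comm k v w x y :
  cl_vec v * cl_vec w + cl_vec w * cl_vec v =
    k *: (cl_vec x * cl_vec y + cl_vec y * cl_vec x) :> Cl ->
  dot v w = k * dot x y.
Proof.
rewrite -!dot_cl scalerA => /scalar_cl_inj; rewrite mulrN => /oppr_inj.
by rewrite mulrCA; apply: mulfI; rewrite pnatr_eq0.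
Qed.

(** The map x |-> k g x g is k (g, g) times the reflection in the hyperplane orthogonal to g. *)
Lemma dot_sandwich k g v w x y :
  cl_vec v = k *: (cl_vec g * cl_vec x * cl_vec g) :> Cl ->
  cl_vec w = k *: (cl_vec g * cl_vec y * cl_vec g) :> Cl ->
  dot v w = (k * dot g g) ^+ 2 * dot x y.
Proof.
move=> vE wE; apply: dot_eq_comm.
have E a b : k *: (cl_vec g * a * cl_vec g) * (k *: (cl_vec g * b * cl_vec g)) =
    - (k ^+ 2 * dot g g) *: (cl_vec g * (a * b) * cl_vec g) :> Cl.
  rewrite -scalerAl -scalerAr scalerA !mulrA -(mulrA (cl_vec g * a) (cl_vec g)) cl_vec_sqr.
  rewrite mulrN mulr_algr !mulNr -!scalerAl scaleNr scalerN scalerA.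
  by congr (- (_ *: _)); exact: esym (mulrA _ _ _).
rewrite vE wE !E -scalerDr -mulrDl -mulrDr -dot_cl mulr_algr -(scalerAl _ (cl_vec g)) cl_vec_sqr.
by rewrite !scalerA mulrN mulNr scalerN -scaleNr scalerA; congr (_ *: _); ring.
Qed.

(** Both maps are multiples of the same reflection, with factors k (g, g) and its inverse. *)
Lemma dot_sandwich_inv k g v w x y : k != 0 -> g != 0 ->
  cl_vec v = k *: (cl_vec g * cl_vec x * cl_vec g) :> Cl ->
  cl_vec w = k^-1 *: ((cl_vec g)^-1 * cl_vec y * (cl_vec g)^-1) :> Cl ->
  dot v w = dot x y.
Proof.
move=> k0 g0 vE wE; rewrite -[RHS]mul1r; apply: dot_eq_comm; rewrite scale1r vE wE.
have ug := cl_vec_unit g0.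
rewrite -!(scalerAl, scalerAr) !scalerA mulfV // mulVf // !scale1r.
rewrite !mulrA !(mulrK ug, mulrVK ug).
have -> : (cl_vec g)^-1 * cl_vec y * cl_vec x * cl_vec g =
    cl_vec g * (cl_vec y * cl_vec x) * (cl_vec g)^-1.
  by rewrite (cl_vec_inv g0) linearZ /= -!(scalerAl, scalerAr) !mulrA.
by rewrite -mulrDl -(mulrA (cl_vec g)) -mulrDr -dot_cl mulr_algr -scalerAl mulrV.
Qed.

(* The relation is df ^ df^c = 0, for df = (a, b) and df^c = (x, y). *)
Lemma christoffel_conformal (a b x y : 'rV[R]_n) rho : 0 < rho ->
  dot a a = rho -> dot b b = rho -> dot a b = 0 ->
  cl_vec a * cl_vec y = cl_vec b * cl_vec x :> Cl ->
  dot x x = dot y y /\ dot x y = 0.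
Proof.
move=> rho0 aa bb ab ayE; have rhoN0 : - rho != 0 by rewrite oppr_eq0 gt_eqF.
have yaE : cl_vec y * cl_vec a = cl_vec x * cl_vec b :> Cl.
  by have /(congr1 (@cl_tr R n)) := ayE; rewrite !cl_trM !cl_tr_vec.
have caa : cl_vec a * cl_vec a = (- rho)%:A :> Cl by rewrite cl_vec_sqr aa scaleNr.
have cbb : cl_vec b * cl_vec b = (- rho)%:A :> Cl by rewrite cl_vec_sqr bb scaleNr.
have cab : cl_vec a * cl_vec b + cl_vec b * cl_vec a = 0 :> Cl.
  by rewrite -dot_cl ab mulr0 oppr0 scale0r.
split.
  apply: scalar_cl_inj; apply: oppr_inj; rewrite -!cl_vec_sqr.
  apply: (scalerI rhoN0).
  have -> : - rho *: (cl_vec x * cl_vec x) = cl_vec x * (cl_vec b * cl_vec b) * cl_vec x :> Cl.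
    by rewrite cbb mulr_algr -scalerAl.
  have -> : - rho *: (cl_vec y * cl_vec y) = cl_vec y * (cl_vec a * cl_vec a) * cl_vec y :> Cl.
    by rewrite caa mulr_algr -scalerAl.
  by rewrite !mulrA -yaE -!mulrA ayE.
suff : dot x y = 0 * dot x y by rewrite mul0r.
apply: dot_eq_comm; rewrite scale0r; apply: (scalerI rhoN0); rewrite scaler0 scalerDr.
have -> : - rho *: (cl_vec x * cl_vec y) = cl_vec x * (cl_vec a * cl_vec b) * cl_vec x :> Cl.
  by rewrite -!mulrA -ayE (mulrA (cl_vec a)) caa mulr_algl scalerAr.
have -> : - rho *: (cl_vec y * cl_vec x) = cl_vec x * (cl_vec b * cl_vec a) * cl_vec x :> Cl.
  by rewrite !mulrA -yaE -(mulrA (cl_vec y)) caa mulr_algr scalerAl.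
by rewrite -mulrDl -mulrDr cab mulr0 mul0r.
Qed.

End VectorIdentities.

Lemma pairing20C {R : realType} {n : nat} (a b : R * R -> 'rV[R]_n) :
  pairing20 a b = pairing20 b a.
Proof.
rewrite /pairing20 (dotC (a (ex R))) (dotC (a (ey R)) (b (ey R))).
by rewrite (dotC (a (ex R))) (dotC (a (ey R))) addrC [X in (_ +i* - (X / _))%C]addrC.
Qed.

(** * The Darboux transform as an isothermic surface *)

Section DarbouxTransform.
Context {R : realType} {M : topologicalType} {n : nat}.
Variables (S : riemann_surface R M) (Q : quadratic_differential S).
Local Notation Cl := (clifford R n).
Variables (f fc g : M -> 'rV[R]_n) (r : R).
Hypotheses (r0 : r != 0) (gsol : darboux_solution S r f fc g).
Local Notation fhat := (darboux_transform f g).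
Local Notation fhatc := (darboux_christoffel r fc g).

Lemma qd_nonzero_chart p c : qd_nonzero_at Q p -> atlas S c -> chart_dom c p ->
  Q c (c p) != 0.
Proof.
move=> [c0 [c0S c0p Q0]] cS cp; have c0z := chart_mapP c0p.
have cK : chart_dom c (chart_inv c0 (c0 p)) by rewrite chart_mapK.
have [w dw] := atlas_holomorphic c0S cS c0z cK.
apply: contraNneq Q0; rewrite (qd_transition Q c0S cS c0z cK dw).
by rewrite /transition chart_mapK // => ->; rewrite mul0r.
Qed.

Lemma vsmooth_darboux : vsmooth S f -> vsmooth S fhat.
Proof.
move=> sf i; have [sg _ _] := gsol.
rewrite (_ : (fun p => _) = fun p => f p 0 i + g p 0 i); first exact: smoothD.
by apply/funext => p; rewrite mxE.
Qed.

Lemma darboux_inv_vec p : is_vec (cl_vec (r *: g p) : Cl)^-1.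
Proof.
have [_ g0 _] := gsol; rewrite cl_vec_inv ?scaler_eq0 ?negb_or ?r0 ?g0 //.
exact: is_vec_cl_vec.
Qed.

Lemma vsmooth_darboux_inv : vsmooth S (fun p => vec_part (cl_vec (r *: g p))^-1).
Proof.
move=> i; have [sg g0 _] := gsol.
have srg j : smooth S (fun p => (r *: g p) 0 j).
  rewrite (_ : (fun p => _) = fun p => r * g p 0 j).
    by apply: smoothM => //; exact: smooth_cst.
  by apply/funext => p; rewrite mxE.
have rg0 p : r *: g p != 0 by rewrite scaler_eq0 negb_or r0 g0.
rewrite (_ : (fun p => _) = fun p => -1 * (dot (r *: g p) (r *: g p))^-1 * (r *: g p) 0 i).
  apply: smoothM => //; apply: smoothM; first exact: smooth_cst.
  apply: smoothV => [p|]; first by rewrite dot_eq0.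
  by apply: smooth_sum => j; apply: smoothM.
apply/funext => p; rewrite cl_vec_inv // cl_vecK mxE mulN1r //.
Qed.

Lemma vsmooth_darboux_christoffel : vsmooth S fc -> vsmooth S fhatc.
Proof.
move=> sfc i; have si := vsmooth_darboux_inv i.
rewrite (_ : (fun p => _) = fun p => fc p 0 i + vec_part (cl_vec (r *: g p))^-1 0 i).
  exact: smoothD.
by apply/funext => p; rewrite mxE.
Qed.

Section AtPoint.
Variables (c : chart R M) (z : R * R).
Hypotheses (cS : atlas S c) (cz : chart_im c z).
Local Notation p := (chart_inv c z).

Lemma vdform_darboux X : vsmooth S f -> cl_vec (vdform fhat c z X) =
  r *: (cl_vec (g p) * cl_vec (vdform fc c z X) * cl_vec (g p)) :> Cl.
Proof.
move=> sf; have [sg g0 eqg] := gsol.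
rewrite -(cldform_vec cS cz _ (vsmooth_darboux sf)).
rewrite (_ : (fun q => _) = fun q => cl_vec (f q) + cl_vec (g q)); last first.
  by apply/funext => q; rewrite linearD.
rewrite (cldformD cS cz X (clsmooth_vec sf) (clsmooth_vec sg)).
by rewrite !(cldform_vec cS cz) // (eqg c z X cS cz) addrC subrK.
Qed.

Lemma vdform_darboux_christoffel X : vsmooth S f -> vsmooth S fc ->
  cl_vec (vdform fhatc c z X) =
  r^-1 *: ((cl_vec (g p))^-1 * cl_vec (vdform f c z X) * (cl_vec (g p))^-1) :> Cl.
Proof.
move=> sf sfc; have [sg g0 eqg] := gsol; have ug := cl_vec_unit (g0 p).
have sw := vsmooth_darboux_inv; have scw := clsmooth_vec sw; have scg := clsmooth_vec sg.
pose w q : Cl := cl_vec (vec_part (cl_vec (r *: g q))^-1).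
(* Differentiating this constant product gives dw = - w dg g^-1; inserting the equation for dg then
   cancels df^c. *)
have wg q : w q * cl_vec (g q) = r^-1%:A.
  rewrite /w vec_partK; last exact: darboux_inv_vec.
  have urg : (cl_vec (r *: g q) : Cl) \is a GRing.unit.
    by apply: cl_vec_unit; rewrite scaler_eq0 negb_or r0 g0.
  have -> : cl_vec (g q) = r^-1 *: cl_vec (r *: g q) :> Cl.
    by rewrite linearZ /= scalerA mulVf // scale1r.
  by rewrite -scalerAr mulVr.
have wE : w p = r^-1 *: (cl_vec (g p))^-1.
  by rewrite -[LHS](mulrK ug) wg mulr_algl.
have dw : cldform w c z X * cl_vec (g p) + w p * cl_vec (vdform g c z X) = 0.
  rewrite -(cldform_vec cS cz _ sg) -(cldformM cS cz X scw scg).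
  rewrite (_ : (fun q => _) = fun=> r^-1%:A); first exact: cldform_cst.
  by apply/funext => q; exact: wg.
rewrite -(cldform_vec cS cz _ (vsmooth_darboux_christoffel sfc)).
rewrite (_ : (fun q => _) = fun q => cl_vec (fc q) + w q); last first.
  by apply/funext => q; rewrite linearD.
rewrite (cldformD cS cz X (clsmooth_vec sfc) scw) (cldform_vec cS cz) //.
have -> : cldform w c z X = - (w p * cl_vec (vdform g c z X) * (cl_vec (g p))^-1).
  by apply/eqP; rewrite -addr_eq0 -[X in X + _](mulrK ug) -mulrDl dw mul0r.
rewrite wE (eqg c z X cS cz) mulrBr mulrBl opprB -!(scalerAl, scalerAr) scalerA.
by rewrite mulVf // scale1r !mulrA mulVr // mul1r mulrK // addrCA subrr addr0.
Qed.

End AtPoint.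

Lemma vdform_coord (k : M -> 'rV[R]_n) c z (X : R * R) :
  vdform k c z X = X.1 *: vdform k c z (ex R) + X.2 *: vdform k c z (ey R).
Proof. by apply/rowP => i; rewrite !mxE /dform /= !mul1r !mul0r addr0 add0r. Qed.

Lemma isothermic_darboux : isothermic setT Q f fc ->
  isothermic (qd_nonzero_at Q) Q fhat fhatc.
Proof.
move=> [sf cf [sfc wedge pairing]]; have [sg g0 eqg] := gsol.
split; first exact: vsmooth_darboux.
- move=> q Qq c cS cq; have cz := chart_mapP cq; have [rho rho0 rhoE] := cf q I c cS cq.
  pose x := vdform fc c (c q) (ex R); pose y := vdform fc c (c q) (ey R).
  (* Since dfhat = r g df^c g is a similarity applied to df^c, it suffices that df^c is conformal
     and nonzero. *)
  have [xy xy0] : dot x x = dot y y /\ dot x y = 0.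
    apply: (christoffel_conformal rho0 (a := vdform f c (c q) (ex R))
      (b := vdform f c (c q) (ey R))); rewrite ?rhoE /= ?(mulr0, mulr1, addr0, add0r) //.
    by apply/eqP; rewrite -subr_eq0 wedge.
  (* If df^c vanished here, so would Q = (df, df^c)^{2,0}. *)
  have sigma0 : dot x x != 0.
    apply: contra (qd_nonzero_chart Qq cS cq) => xx.
    have x0 : x = 0 by apply/eqP; rewrite -dot_eq0.
    have y0 : y = 0 by apply/eqP; rewrite -dot_eq0 -xy.
    by rewrite -pairing // /pairing20 -/x -/y x0 y0 !(dotC _ 0) !dot0l subrr addr0 mul0r oppr0.
  exists ((r * dot (g q) (g q)) ^+ 2 * dot x x).
    apply: mulr_gt0; last by rewrite lt0r sigma0 dot_ge0.
    by rewrite lt0r sqr_ge0 sqrf_eq0 mulf_neq0 // dot_eq0.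
  move=> X Y; have vE V := vdform_darboux cS cz V sf.
  rewrite (dot_sandwich (vE X) (vE Y)) chart_mapK // -[RHS]mulrA; congr (_ * _).
  rewrite (vdform_coord fc _ _ X) (vdform_coord fc _ _ Y) -/x -/y.
  rewrite dotDl !(dotC (_ *: _) (_ + _)) !dotDl !dotZl !(dotC _ (_ *: _)) !dotZl.
  by rewrite -xy (dotC y x) xy0; ring.
split; first exact: vsmooth_darboux_christoffel.
- move=> c z X Y cS cz.
  rewrite (vdform_darboux cS cz X sf) (vdform_darboux cS cz Y sf).
  rewrite (vdform_darboux_christoffel cS cz X sf sfc).
  rewrite (vdform_darboux_christoffel cS cz Y sf sfc).
  have ug := cl_vec_unit (g0 (chart_inv c z)).
  rewrite -!(scalerAl, scalerAr) !scalerA mulfV // !scale1r !mulrA !(mulrK ug).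
  rewrite -mulrBl -!(mulrA (cl_vec (g _))) -mulrBr.
  (* The wedge of the new pair is g (df^c ^ df) g^-1, and df^c ^ df = 0 is the transpose of df ^
     df^c = 0. *)
  have /(congr1 (@cl_tr R n)) := wedge c z Y X cS cz.
  rewrite linearB linear0 /= !cl_trM !cl_tr_vec => ->.
  by rewrite mulr0 mul0r.
- move=> c z cS cz; rewrite -(pairing c z cS cz) pairing20C.
  have dE X Y : dot (vdform fhatc c z X) (vdform fhat c z Y) =
      dot (vdform f c z X) (vdform fc c z Y).
    rewrite dotC [RHS]dotC.
    exact: dot_sandwich_inv r0 (g0 (chart_inv c z)) (vdform_darboux cS cz Y sf)
      (vdform_darboux_christoffel cS cz X sf sfc).
  by rewrite /pairing20 (dE (ex R) (ex R)) (dE (ey R) (ey R)) (dE (ex R) (ey R))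
    (dE (ey R) (ex R)).
Qed.

(* The pair (fhat, f) is again a Darboux pair of parameter r. *)
Lemma darboux_solution_opp : vsmooth S f -> vsmooth S fc ->
  darboux_solution S r fhat fhatc (fun p => - g p).
Proof.
move=> sf sfc; have [sg g0 eqg] := gsol.
have sN : vsmooth S (fun p => - g p).
  move=> i; rewrite (_ : (fun p => _) = fun p => -1 * g p 0 i).
    by apply: smoothM => //; exact: smooth_cst.
  by apply/funext => p; rewrite mxE mulN1r.
split; [exact: sN|by move=> p; rewrite oppr_eq0|move=> c z X cS cz /=].
have ug := cl_vec_unit (g0 (chart_inv c z)).
rewrite -(cldform_vec cS cz _ sN) (_ : (fun q => _) = fun q => - cl_vec (g q)); last first.
  by apply/funext => q; rewrite linearN.
rewrite (cldformN cS cz X (clsmooth_vec sg)) (cldform_vec cS cz) // (eqg c z X cS cz).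
rewrite (vdform_darboux cS cz X sf) (vdform_darboux_christoffel cS cz X sf sfc).
rewrite (linearN (@cl_vec R n) (g _)) /= mulNr mulrNN -scalerAr -scalerAl scalerA.
by rewrite mulfV // scale1r !mulrA mulrV // mul1r mulrVK // opprB.
Qed.

Lemma darboux_transform_opp : darboux_transform fhat (fun p => - g p) = f.
Proof. by apply/funext => p; exact: addrK. Qed.

End DarbouxTransform.

(** * Exchanging the two surfaces of a pair *)

Section Swap.
Context {R : realType} {M : topologicalType} {n : nat}.
Variable S : riemann_surface R M.
Local Notation Cl := (clifford R n).
Implicit Types (A : 'M[Cl]_2) (F : M -> 'M[Cl]_2).

(* The Moebius transformation x |-> - x^-1 exchanges 0 and infinity. *)
Definition swap_mx : 'M[Cl]_2 := mx2 0 1 (-1) 0.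

(** The conjugate J^-1 A J for J = [swap_mx]. *)
Definition swap_form (A : mx_form R M n) : mx_form R M n := fun c z X =>
  mx2 (A c z X 1 1) (- A c z X 1 0) (- A c z X 0 1) (A c z X 0 0).

Lemma swap_SLGamma : (0 < n)%N -> SLGamma swap_mx.
Proof.
move=> n0; have g1 : clifford0 (1 : Cl) by right; exact: clifford_group1.
apply/SLGammaE; rewrite !mx2E; split.
- by split=> //; [left|rewrite -scaleN1r; apply: clifford0Z|left].
- by rewrite mul0r linear0 mulr0; split; exact: is_vec0.
- by rewrite linear0 mul0r mulr0; split; exact: is_vec0.
- by rewrite mul0r sub0r mul1r cl_trN cl_tr1 opprK.
Qed.

Lemma mulmx_swap A : A *m swap_mx = mx2 (- A 0 1) (A 0 0) (- A 1 1) (A 1 0).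
Proof.
by apply: mx2P; rewrite mulmx2E !mx2E ?mulr0 ?mulr1 ?mulrN1 ?add0r ?addr0.
Qed.

Lemma mobius_swap A :
  mobius (A *m swap_mx) (Some 0) = mobius A None /\
  mobius (A *m swap_mx) None = mobius A (Some 0).
Proof.
by rewrite mulmx_swap /mobius !mx2E linear0 !mulr0 !add0r oppr_eq0 invrN mulrNN.
Qed.

Lemma frame_swap F (A : mx_form R M n) : (0 < n)%N -> is_frame_of S F A ->
  is_frame_of S (fun p => F p *m swap_mx) (swap_form A).
Proof.
move=> n0 [sF slF dF].
have sJ : mxsmooth S (fun=> swap_mx) by move=> i j K; exact: smooth_cst.
split=> [|p|c z X cS cz]; first exact: mxsmoothM.
  by apply: SLGammaM => //; exact: swap_SLGamma.
rewrite (mxdformM cS cz) // dF // -!mulmxA.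
have -> : mxdform (fun=> swap_mx) c z X = 0.
  by apply/matrixP => i j; rewrite mxdformE cldform_cst mxE.
rewrite mulmx0 addr0; congr (_ *m _).
by apply: mx2P; rewrite mulmx_swap mulmx2E !mx2E ?mul0r ?mul1r ?mulN1r ?opprK ?add0r ?addr0.
Qed.

(** Conjugation by the exchange matrix preserves the splitting into diagonal and off-diagonal parts,
    hence commutes with scaling the latter by lam. *)
Lemma associated_family_swap lam (f g : M -> 'rV[R]_n) (h hhat : M -> sphere R n) : (0 < n)%N ->
  associated_family S lam f (darboux_transform f g) h hhat ->
  associated_family S lam (darboux_transform f g)
    (darboux_transform (darboux_transform f g) (fun p => - g p)) hhat h.
Proof.
move=> n0 [F [A [Flam [frF pF frFl hE]]]].
exists (fun p => F p *m swap_mx), (swap_form A), (fun p => Flam p *m swap_mx); split.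
- exact: frame_swap.
- move=> p; have [-> ->] := mobius_swap (F p); have [-> ->] := pF p.
  by rewrite darboux_transform_opp.
- have [sG slG dG] := frame_swap n0 frFl; split=> // c z X cS cz; rewrite dG //.
  by rewrite /swap_form !curved_flat_form !mx2E !scalerN.
- by move=> p; have [-> ->] := mobius_swap (Flam p); have [] := hE p.
Qed.

Lemma T_transform_unique (Q : quadratic_differential S) s
  (f fc : M -> 'rV[R]_n) (h h' : M -> sphere R n) (p0 : M) : (0 < n)%N ->
  T_transform Q s f fc h -> T_transform Q s f fc h' -> mobius_equivalent h h'.
Proof.
move=> n0 [_ [F [frF hE]]] [_ [G [frG h'E]]].
have [B slB FE] := frame_unique p0 n0 (fun c z X _ _ => T_form_vadj s f fc c z X) frF frG.
exists B => // p; rewrite hE h'E FE mobius_mul0 //.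
by case: frG.
Qed.

Lemma T_transform_pair (Q : quadratic_differential S)
  (f fc g : M -> 'rV[R]_n) r lam (h hhat : M -> sphere R n) (p0 : M) : (0 < n)%N -> lam != 0 ->
  isothermic (qd_nonzero_at Q) Q f fc -> darboux_solution S r f fc g ->
  associated_family S lam f (darboux_transform f g) h hhat ->
  let s := (1 - lam ^+ 2) * r in
  T_transform Q s f fc h /\
  forall h', T_transform Q s f fc h' -> mobius_equivalent h h'.
Proof.
move=> n0 lam0 iso gsol [F [A [Flam [frF pF frFl hE]]]] s.
have [sf _ _] := iso.
have [G [frG GE]] := T_frame_exists sf gsol lam0 frF pF frFl n0.
have Th : T_transform Q s f fc h.
  by split=> //; exists G; split=> // p; rewrite GE; case: (hE p).
by split=> // h'; exact: T_transform_unique.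
Qed.

End Swap.

Unset Implicit Arguments.

Theorem theorem3p4 (R : realType) (n : nat) (M : topologicalType)
  (S : riemann_surface R M) (Q : quadratic_differential S)
  (f fc g : M -> 'rV[R]_n) (r lam : R)
  (h hhat : M -> sphere R n) :
  simply_connected R M ->
  polarisation Q ->
  isothermic setT Q f fc ->
  r != 0 ->
  darboux_solution S r f fc g ->
  lam != 0 ->
  associated_family S lam f (darboux_transform f g) h hhat ->
  let s := (1 - lam ^+ 2) * r in
  let fhat := darboux_transform f g in
  let fhatc := darboux_christoffel r fc g in
  (T_transform Q s f fc h /\
   forall h', T_transform Q s f fc h' -> mobius_equivalent h h') /\
  (T_transform Q s fhat fhatc hhat /\
   forall h', T_transform Q s fhat fhatc h' -> mobius_equivalent hhat h').
Proof.
move=> _ [p0 _] iso r0 gsol lam0 fam s fhat fhatc.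
have [sf cf chr] := iso; have [sfc _ _] := chr.
(* In dimension 0 the vector g(p0) could not be nonzero. *)
have n0 : (0 < n)%N.
  have [_ g0 _] := gsol; rewrite lt0n; apply: contraNneq (g0 p0) => n00.
  by apply/eqP/rowP => i; have := ltn_ord i; rewrite {2}n00.
split.
  apply: (T_transform_pair p0 n0 lam0 _ gsol fam).
  by split=> // p _; exact: cf.
apply: (T_transform_pair p0 n0 lam0 (isothermic_darboux r0 gsol iso) _
  (associated_family_swap n0 fam)).
exact: darboux_solution_opp.
Qed.
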